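(* Consider the problem $$\min_{x\in\mathbb{R}^{d_x}}\max_{y\in\mathbb{R}^{d_y}}\{f(x)+G(x,y)-h(y)\},\qquad G(x,y)=\frac1{m_G}\sum_{i=1}^{m_G}G_i(x,y),$$ where $f$ is $\mu_x$-strongly convex, $h$ is $\mu_y$-strongly convex, $f$ and $h$ are prox-friendly (smoothness of $f$ and $h$ is not required), each $G_i$ is convex in $x$, concave in $y$ and $L_G^i$-smooth jointly in $(x,y)$, and $L_G=\frac1{m_G}\sum_{i=1}^{m_G}L_G^i$. Suppose $\mu_x\sqrt{m_G}\le L_G$ and $\mu_y\sqrt{m_G}\le L_G$. Then for any $\varepsilon>0$, $\sigma\in(0,1)$ there is a (randomized) algorithm that finds an $(\varepsilon,\sigma)$-solution to this problem, for which the number of oracle calls of $\nabla_xG_i(x,y)$, of oracle calls of $\nabla_yG_i(x,y)$, and of proximal computations for $f$ and for $h$ is $$\widetilde O\left(\sqrt{\frac{m_GL_G^2}{\mu_x\mu_y}}\right).$$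
   Context: Norms are Euclidean. $G_i$ is $L_G^i$-smooth: $\|\nabla G_i(x_1,x_2)-\nabla G_i(y_1,y_2)\|\le L_G^i\|(x_1,x_2)-(y_1,y_2)\|$ on $\mathbb{R}^{d_x}\times\mathbb{R}^{d_y}$. A proximal computation for $f$ is solving one problem $\min_x\{\langle c_1,x\rangle+f(x)+\frac{c_2}2\|x-\bar x\|^2\}$ with fixed $c_1,\bar x$ and $c_2>0$; similarly for $h$; prox-friendly means these can be carried out exactly. $\widetilde O(X)$ hides constant factors and factors polylogarithmic in $\varepsilon^{-1}$ and $\sigma^{-1}$. A (random) point $(\hat x,\hat y)$ is an $(\varepsilon,\sigma)$-solution of the saddle-point problem if with probability at least $1-\sigma$: $\max_{y}\{f(\hat x)+G(\hat x,y)-h(y)\}-\min_{x}\{f(x)+G(x,\hat y)-h(\hat y)\}\le\varepsilon$. *)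

(* Defs.v *)
From mathcomp Require Export all_boot all_order all_algebra.
From mathcomp Require Export all_classical all_reals all_analysis.
Export Order.TTheory GRing.Theory Num.Theory.
Export numFieldNormedType.Exports.

Set Implicit Arguments.
Unset Strict Implicit.
Unset Printing Implicit Defensive.

Local Open Scope classical_set_scope.
Local Open Scope ring_scope.

Section euclidean.
Context {R : realType} {d : nat}.
Implicit Types x y : 'rV[R]_d.

Definition dot x y : R := \sum_(j < d) x 0 j * y 0 j.

(* The library norm of ['rV[R]_d] is the sup norm. *)
Definition enorm x : R := Num.sqrt (dot x x).

Definition gradient (phi : 'rV[R]_d -> R) x : 'rV[R]_d :=
  \row_(j < d) 'D_(delta_mx 0 j) (phi : 'rV[R]_d -> R^o) x.

Definition strongly_convex (mu : R) (phi : 'rV[R]_d -> R) :=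
  forall (t : R) x y, 0 <= t -> t <= 1 ->
    phi (t *: x + (1 - t) *: y) <=
      t * phi x + (1 - t) * phi y - mu / 2 * t * (1 - t) * enorm (x - y) ^+ 2.

Definition prox_objective (phi : 'rV[R]_d -> R) (c1 : 'rV[R]_d) (c2 : R)
    (xbar x : 'rV[R]_d) : R :=
  dot c1 x + phi x + c2 / 2 * enorm (x - xbar) ^+ 2.

End euclidean.

Definition is_max {R : realType} (A : set R) (M : R) := A M /\ ubound A M.
Definition is_min {R : realType} (A : set R) (M : R) := A M /\ lbound A M.

Section saddle.
Context {R : realType} {dx dy : nat}.
Notation X := 'rV[R]_dx.
Notation Y := 'rV[R]_dy.
Implicit Types (f : X -> R) (h : Y -> R) (G : X -> Y -> R).

Definition gradx G (x : X) (y : Y) : X := gradient (fun u => G u y) x.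
Definition grady G (x : X) (y : Y) : Y := gradient (fun v => G x v) y.

Definition pair_norm (x : X) (y : Y) : R :=
  Num.sqrt (enorm x ^+ 2 + enorm y ^+ 2).

Definition smooth (L : R) G :=
  (forall z : X * Y, differentiable (fun w : X * Y => G w.1 w.2 : R^o) z) /\
  (forall x1 x2 y1 y2,
     pair_norm (gradx G x1 x2 - gradx G y1 y2) (grady G x1 x2 - grady G y1 y2)
     <= L * pair_norm (x1 - y1) (x2 - y2)).

Definition convex_concave G :=
  (forall y, convex_function setT (fun x => G x y : R^o)) /\
  (forall x, convex_function setT (fun y => - G x y : R^o)).

Definition objective f h G (x : X) (y : Y) : R := f x + G x y - h y.

Definition eps_solution f h G (eps : R) : set (X * Y) :=
  [set z | exists M m : R,
     [/\ is_max [set objective f h G z.1 y | y in setT] M,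
         is_min [set objective f h G x z.2 | x in setT] m &
         M - m <= eps]].

Definition saddle_point f h G (x : X) (y : Y) :=
  forall x' y', objective f h G x y' <= objective f h G x y
                /\ objective f h G x y <= objective f h G x' y.

End saddle.

(* Randomized algorithms in the oracle model: decision trees whose inner nodes
   are oracle calls or draws from a finite distribution. A tree sees the
   functions only through the answers of the oracle; all other computations
   are free and exact. *)
Record fin_dist (R : realType) (n : nat) := FinDist {
  weight :> 'I_n -> R;
  weight_ge0 : forall i, 0 <= weight i;
  weight_sum1 : \sum_(i < n) weight i = 1
}.

Inductive call := GradX | GradY | ProxF | ProxH.

Section algorithms.
Context {R : realType} {dx dy m : nat}.
Notation X := 'rV[R]_dx.
Notation Y := 'rV[R]_dy.

(* [(i, x, y)] for a gradient call, [(c1, c2, xbar)] for a proximal one. *)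
Definition input (c : call) : Type :=
  match c with
  | GradX | GradY => 'I_m * X * Y
  | ProxF => X * {posnum R} * X
  | ProxH => Y * {posnum R} * Y
  end.

Definition answer (c : call) : Type :=
  match c with GradX | ProxF => X | GradY | ProxH => Y end.

Definition oracle : Type := forall c, input c -> answer c.

Inductive algorithm : Type :=
| Return of X & Y
| Call (c : call) of input c & (answer c -> algorithm)
| Draw (n : nat) of fin_dist R n & ('I_n -> algorithm).

Fixpoint prob_output (O : oracle) (A : set (X * Y)) (a : algorithm) : R :=
  match a with
  | Return x y => \1_A (x, y)
  | @Call c q k => prob_output O A (k (O c q))
  | @Draw n p k => \sum_(i < n) p i * prob_output O A (k i)
  end.

(* Largest number of calls of kind [c] over all random draws. *)
Fixpoint max_calls (O : oracle) (c : call) (a : algorithm) : nat :=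
  match a with
  | Return _ _ => 0
  | @Call c' q k => `[< c' = c >] + max_calls O c (k (O c' q))
  | @Draw n p k => \max_(i < n) max_calls O c (k i)
  end%N.

Definition oracle_for (f : X -> R) (h : Y -> R) (G : 'I_m -> X -> Y -> R)
    (O : oracle) :=
  [/\ forall i x y, O GradX (i, x, y) = gradx (G i) x y,
      forall i x y, O GradY (i, x, y) = grady (G i) x y,
      forall c1 (c2 : {posnum R}) xbar x,
        prox_objective f c1 c2%:num xbar (O ProxF (c1, c2, xbar))
        <= prox_objective f c1 c2%:num xbar x &
      forall c1 (c2 : {posnum R}) ybar y,
        prox_objective h c1 c2%:num ybar (O ProxH (c1, c2, ybar))
        <= prox_objective h c1 c2%:num ybar y].

End algorithms.
Arguments oracle : clear implicits.
Arguments algorithm : clear implicits.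

Definition average {R : realType} {m : nat} (a : 'I_m -> R) : R :=
  m%:R^-1 * \sum_(i < m) a i.

(* The logarithm hidden by the soft-O. Rescaling the objective, or the space
   together with the starting point, shows that [eps] can only enter relative
   to the scale [L * dist0 ^+ 2] of the instance, where [dist0] is the distance
   from the starting point to the saddle point. The argument of [ln] exceeds 1
   as soon as [mux <= L], [muy <= L] and [0 < sigma < 1]. *)
Definition log_factor {R : realType} (L mux muy dist0 eps sigma : R) : R :=
  ln (L / mux + L / muy + L * dist0 ^+ 2 / eps + sigma^-1).

(* Main.v *)
Require Import Defs.
From HB Require Import structures.
From mathcomp Require Import ring lra zify.

(* Assume [mux <= muy]. Adding [muy / 2 |x - c|^2] makes the problem
   [muy]-strongly convex-concave, and the double-loop variance-reduced
   extragradient method with importance sampling solves it up to a factor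
   [theta] in expected squared distance within
   [O(sqrt m * average L / muy * ln (1 / theta))] calls: an epoch makes [O(m)]
   calls and contracts by [1 - muy * sqrt m / (3 * average L)]. The proximal
   points so computed are approximate gradients of the Moreau envelope of
   [x |-> max_y (f x + G x y - h y)], which is [muy]-smooth and [mux / 2]-strongly
   convex, so Nesterov's method needs [O(sqrt (muy / mux))] of them per digit. The
   product of the two counts is [O(sqrt m * average L / sqrt (mux * muy))].
   The distance to the saddle point is unknown, but the length of one
   proximal gradient step at the starting point bounds it from above up to a
   factor [L / mux] and from below up to a constant, which is enough to choose the
   numbers of iterations. A last proximal gradient step turns proximity to the
   saddle point into a small duality gap, and Markov's inequality turns
   expectations into probabilities. If [muy < mux], exchange the two players. *)

Set Implicit Arguments.
Unset Strict Implicit.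
Unset Printing Implicit Defensive.

Local Open Scope classical_set_scope.
Local Open Scope ring_scope.

(** * Euclidean geometry and strongly convex functions *)

Section dot_theory.
Context {R : realType} {d : nat}.
Implicit Types x y z : 'rV[R]_d.

Lemma dotC x y : dot x y = dot y x.
Proof. by apply: eq_bigr => j _; rewrite mulrC. Qed.

Lemma dotDl x y z : dot (x + y) z = dot x z + dot y z.
Proof.
by rewrite /dot -big_split; apply: eq_bigr => j _; rewrite mxE mulrDl.
Qed.

Lemma dotZl a x y : dot (a *: x) y = a * dot x y.
Proof. by rewrite /dot mulr_sumr; apply: eq_bigr => j _; rewrite mxE mulrA. Qed.

Lemma dotNl x y : dot (- x) y = - dot x y.
Proof. by rewrite -scaleN1r dotZl mulN1r. Qed.

Lemma dotDr x y z : dot z (x + y) = dot z x + dot z y.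
Proof. by rewrite dotC dotDl !(dotC z). Qed.

Lemma dotZr a x y : dot y (a *: x) = a * dot y x.
Proof. by rewrite dotC dotZl dotC. Qed.

Lemma dotNr x y : dot y (- x) = - dot y x.
Proof. by rewrite dotC dotNl dotC. Qed.

Lemma dot0l x : dot 0 x = 0.
Proof. by rewrite -(scale0r 0) dotZl mul0r. Qed.

Definition dotE := (dotDl, dotDr, dotNl, dotNr, dotZl, dotZr).

Definition nsq x : R := dot x x.

Lemma nsq_ge0 x : 0 <= nsq x.
Proof. by apply: sumr_ge0 => j _; rewrite -expr2 sqr_ge0. Qed.

Lemma enorm_sqr x : enorm x ^+ 2 = nsq x.
Proof. by rewrite sqr_sqrtr ?nsq_ge0. Qed.

Lemma nsqN x : nsq (- x) = nsq x.
Proof. by rewrite /nsq !dotE opprK. Qed.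

Lemma nsqBC x y : nsq (x - y) = nsq (y - x).
Proof. by rewrite -nsqN opprB. Qed.

Lemma nsqZ a x : nsq (a *: x) = a ^+ 2 * nsq x.
Proof. by rewrite /nsq !dotE mulrA expr2. Qed.

Lemma nsq0 : nsq 0 = 0.
Proof. exact: dot0l. Qed.

Lemma nsq_eq0 x : nsq x = 0 -> x = 0.
Proof.
move/eqP; rewrite psumr_eq0; last by move=> j _; rewrite -expr2 sqr_ge0.
move=> /allP x0; apply/rowP => j; rewrite mxE; apply/eqP.
by have := x0 j (mem_index_enum j); rewrite -expr2 sqrf_eq0.
Qed.

Lemma nsqD x y : nsq (x + y) = nsq x + nsq y + 2 * dot x y.
Proof. by rewrite /nsq !dotE (dotC y x); ring. Qed.

Lemma young k x y : 0 < k -> 2 * dot x y <= k^-1 * nsq x + k * nsq y.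
Proof.
move=> k0; have := nsq_ge0 (k^-1 *: x - y).
rewrite /nsq !dotE (dotC y x) => /(ler_wpM2l (ltW k0)).
rewrite mulr0; set a := dot x x; set b := dot x y; set c := dot y y.
have -> : k * (k^-1 * (k^-1 * a) - k^-1 * b - (k^-1 * b - c)) =
  k^-1 * a - 2 * b + k * c by field; lra.
by move=> ?; lra.
Qed.

Lemma nsqD_le x y : nsq (x + y) <= 2 * nsq x + 2 * nsq y.
Proof.
by have := young x y (@ltr01 R); rewrite nsqD invr1; lra.
Qed.

Lemma nsq_convex (t : R) x y : 0 <= t <= 1 ->
  nsq (t *: x + (1 - t) *: y) <= t * nsq x + (1 - t) * nsq y.
Proof.
move=> /andP[t0 t1]; have := nsq_ge0 (x - y).
move=> /(ler_wpM2l (mulr_ge0 t0 (_ : 0 <= 1 - t))); rewrite subr_ge0 => /(_ t1).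
by rewrite /nsq !dotE (dotC y x) => ?; nra.
Qed.

Lemma nsq_le_norm x : nsq x <= d%:R * `|x| ^+ 2.
Proof.
rewrite /nsq /dot -[X in X%:R](card_ord d) -sum1_card natr_sum mulr_suml.
apply: ler_sum => j _; rewrite -expr2 mul1r -[leLHS]ger0_norm ?sqr_ge0// normrX.
by rewrite lerXn2r ?nnegrE// [leRHS]/Num.Def.normr/= mx_normrE (le_bigmax _ _ (0, j)).
Qed.

Lemma norm_le_nsq x : `|x| ^+ 2 <= nsq x.
Proof.
rewrite -[leRHS]sqr_sqrtr ?nsq_ge0// lerXn2r ?nnegrE ?sqrtr_ge0//.
rewrite [leLHS]/Num.Def.normr/= mx_normrE bigmax_le ?sqrtr_ge0// => -[i j] _ /=.
rewrite ord1 -(sqrtr_sqr (x 0 j)) ler_sqrt ?nsq_ge0// /nsq /dot (bigD1 j)//=.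
by rewrite expr2 lerDl sumr_ge0// => k _; rewrite -expr2 sqr_ge0.
Qed.

End dot_theory.

(** Makes completeness of row vectors available to the Banach fixed point theorem. *)
HB.instance Definition _ (R : realType) (d : nat) := Complete.on 'rV[R]_d.

(** A high iterate of [T] is a contraction even for the sup norm, by equivalence of norms. Its fixed
    point [z] is fixed by [T] too, because [T z] and [z] are moved by that iterate exactly as far
    apart as they were. *)
Lemma euclidean_banach (R : realType) (d : nat) (T : 'rV[R]_d -> 'rV[R]_d) (q : R) :
  0 <= q < 1 -> (forall z z', nsq (T z - T z') <= q * nsq (z - z')) ->
  exists z, T z = z.
Proof.
move=> /andP[q0 q1] Tq.
have iterT n z z' : nsq (iter n T z - iter n T z') <= q ^+ n * nsq (z - z').
  elim: n => [|n IH] /=; first by rewrite expr0 mul1r.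
  by rewrite (le_trans (Tq _ _))// exprS -mulrA ler_wpM2l.
(* With [d.+1] in place of [d] the bound gives both [q ^+ n * d <= 1 / 4], hence the factor [1 / 2]
   in the sup norm, and [q ^+ n < 1], even when [d = 0]. *)
have [n dq] : exists n, q ^+ n * d.+1%:R <= 1 / 4.
  have : q ^+ n @[n --> \oo] --> (0 : R) by apply: cvg_expr; rewrite ger0_norm.
  move=> /cvgrPdist_le/(_ (1 / 4 / d.+1%:R)) [|N _ /(_ N (leqnn N))] /=.
    by rewrite divr_gt0.
  rewrite sub0r normrN ger0_norm ?exprn_ge0// => h; exists N.
  by rewrite ler_pdivlMr// in h.
have qn0 : 0 <= q ^+ n by rewrite exprn_ge0.
have d0 : 0 <= d%:R :> R by [].
have [||z _ zE] := @banach_fixed_point R _ setT (totalfun (iter n T)) _ closedT.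
- exists (1 / 2)%:nng; split=> /=; first by lra.
  move=> [z z'] _ /=; rewrite /totalfun_.
  rewrite -(@ler_pXn2r _ 2) ?nnegrE ?mulr_ge0 ?divr_ge0//.
  rewrite (le_trans (norm_le_nsq _))// (le_trans (iterT n _ _))//.
  rewrite (le_trans (ler_wpM2l _ (nsq_le_norm _)))// exprMn mulrA.
  by rewrite ler_wpM2r//; move: dq; rewrite -(natr1 d); nra.
- by exists 0.
exists z; apply/eqP; rewrite -subr_eq0; apply/eqP/nsq_eq0/eqP.
rewrite eq_le nsq_ge0 andbT.
have := iterT n (T z) z; rewrite -iterSr iterS -[iter n T z]/(totalfun (iter n T) z).
rewrite -zE; move: dq; rewrite -(natr1 d); have := nsq_ge0 (T z - z); nra.
Qed.

Section subgrad.
Context {R : realType} {d : nat}.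
Implicit Types (phi : 'rV[R]_d -> R) (u g s : 'rV[R]_d).

(** The limit [t -> 0], reached by a single explicit [t] that would contradict [A < 0]. *)
Lemma affine_ge0 (A B : R) :
  (forall t, 0 < t -> t < 1 -> 0 <= A + t * B) -> 0 <= A.
Proof.
move=> AB; rewrite leNgt; apply/negP => A0.
have B0 := normr_ge0 B; have BB := ler_norm B.
have D0 : 0 < - A + `|B| + 1 by lra.
have := AB (- A / (- A + `|B| + 1)).
rewrite divr_gt0 ?oppr_gt0// ltr_pdivrMr// mul1r.
have -> : A + - A / (- A + `|B| + 1) * B = - A * (B - (- A + `|B| + 1)) / (- A + `|B| + 1).
  by field; rewrite gt_eqF.
rewrite pmulr_lge0 ?invr_gt0// => /(_ isT).
have -> : - A < - A + `|B| + 1 by lra.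
by move=> /(_ isT); nra.
Qed.

(** As [f] and [h] need not be differentiable, optimality conditions are expressed by this
    subgradient inequality, which carries the strong convexity term. *)
Definition subgrad (phi : 'rV[R]_d -> R) (mu : R) (u g : 'rV[R]_d) :=
  forall s, phi u + dot g (s - u) + mu / 2 * nsq (s - u) <= phi s.

(** Fermat's rule: compare the minimizer with the points [u + t (s - u)], divide by [t] and let [t]
    tend to 0. *)
Lemma prox_subgrad phi mu c1 c2 xbar u : strongly_convex mu phi ->
  (forall x, prox_objective phi c1 c2 xbar u <= prox_objective phi c1 c2 xbar x) ->
  subgrad phi mu u (c2 *: (xbar - u) - c1).
Proof.
move=> phi_sc umin s; rewrite -subr_ge0.
apply: (@affine_ge0 _ ((mu + c2) / 2 * nsq (s - u))) => t t0 t1.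
rewrite -(pmulr_rge0 _ t0).
have := umin (t *: s + (1 - t) *: u).
have := phi_sc t s u (ltW t0) (ltW t1).
rewrite /prox_objective !enorm_sqr.
have ->: t *: s + (1 - t) *: u = u + t *: (s - u).
  by apply/rowP => j; rewrite !mxE; ring.
have ->: u + t *: (s - u) - xbar = u - xbar + t *: (s - u) by rewrite addrAC.
rewrite -[xbar - u]opprB; move: (s - u) (u - xbar) => v w.
by rewrite nsqD nsqZ !dotE => h1 h2; nra.
Qed.

Lemma subgrad_mono phi mu u u' g g' : subgrad phi mu u g -> subgrad phi mu u' g' ->
  mu * nsq (u - u') <= dot (g - g') (u - u').
Proof.
move=> /(_ u') h /(_ u) h'.
move: h h'; rewrite (nsqBC u' u) -(opprB u u') !dotE; lra.
Qed.

End subgrad.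

(** * Couplings *)

Section first_order.
Context {R : realType} {d : nat}.
Implicit Types (phi : 'rV[R]_d -> R) (x v : 'rV[R]_d).

Lemma derive_gradient phi x v : differentiable (phi : _ -> R^o) x ->
  'D_v (phi : _ -> R^o) x = dot (gradient phi x) v.
Proof.
move=> dphi; rewrite deriveE// {1}(row_sum_delta v) linear_sum.
by apply: eq_bigr => j _; rewrite linearZ/= mxE deriveE// mulrC.
Qed.

(** By convexity the difference quotients in the direction [y - x] stay below [phi y - phi x]; their
    limit is the directional derivative. *)
Lemma convex_gradient phi x y : differentiable (phi : _ -> R^o) x ->
  convex_function setT (phi : _ -> R^o) ->
  phi x + dot (gradient phi x) (y - x) <= phi y.
Proof.
move=> dphi cphi; rewrite -derive_gradient// -lerBrDl.
have /(_ (y - x)) := @diff_derivable _ _ _ _ _ _ dphi.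
move=> /cvg_dnbhs_at_right dq; apply: (cvgr_to_le dq).
near=> t.
have t0 : 0 < t by near: t; exact: nbhs_right_gt.
have t1 : t <= 1 by near: t; exact: nbhs_right_le.
rewrite /= ler_pdivrMl//.
have t01 : 0 <= t <= 1 by rewrite ltW.
have := cphi (Itv01 (ltW t0) t1) y x (in_setT _) (in_setT _).
rewrite -[X in phi X]/(t *: y + (1 - t) *: x).
rewrite -[X in _ <= X]/(t * phi y + (1 - t) * phi x).
have -> : t *: y + (1 - t) *: x = t *: (y - x) + x.
  by rewrite scalerBl scalerBr scale1r addrCA addrC.
by move=> h; nra.
Unshelve. all: by end_near.
Qed.

End first_order.

Section oracle_facts.
Context {R : realType} {dx dy : nat}.
Notation X := 'rV[R]_dx.
Notation Y := 'rV[R]_dy.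

(* What the algorithms use about a coupling term, with [gx] and [gy] playing the
   role of its partial gradients and [L2] of the square of its smoothness
   constant. *)
Record coupling (G : X -> Y -> R) (gx : X -> Y -> X) (gy : X -> Y -> Y) (L2 : R) := {
  coupling_convex : forall x y x', G x y + dot (gx x y) (x' - x) <= G x' y;
  coupling_concave : forall x y y', G x y' <= G x y + dot (gy x y) (y' - y);
  coupling_lipschitz : forall x y x' y',
    nsq (gx x y - gx x' y') + nsq (gy x y - gy x' y')
      <= L2 * (nsq (x - x') + nsq (y - y'))
}.

Lemma pair_norm_sqr (x : X) (y : Y) : pair_norm x y ^+ 2 = nsq x + nsq y.
Proof. by rewrite sqr_sqrtr !enorm_sqr// addr_ge0 ?nsq_ge0. Qed.

Lemma gradyN (G : X -> Y -> R) x y :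
  (forall z : X * Y, differentiable (fun w : X * Y => G w.1 w.2 : R^o) z) ->
  gradient (fun v => - G x v) y = - grady G x y.
Proof.
move=> dG; apply/rowP => j; rewrite !mxE.
have dGy : differentiable (fun v => G x v : R^o) y.
  exact: (@differentiable_comp _ _ _ _ (fun v => (x, v)) (fun w : X * Y => G w.1 w.2 : R^o)).
by rewrite -[LHS]/('D_(delta_mx 0 j) (- (fun v => G x v : R^o)) y) deriveN//; exact: diff_derivable.
Qed.

Lemma smooth_coupling (G : X -> Y -> R) L : 0 <= L -> convex_concave G -> smooth L G ->
  coupling G (gradx G) (grady G) (L ^+ 2).
Proof.
move=> L0 [cvxG ccvG] [dG lipG]; split.
- move=> x y x'; apply: (@convex_gradient _ _ (fun u => G u y) x x' _ (cvxG y)).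
  exact: (@differentiable_comp _ _ _ _ (fun u => (u, y)) (fun w : X * Y => G w.1 w.2 : R^o)).
- move=> x y y'; rewrite -lerN2 opprD -dotNl -gradyN//.
  apply: (@convex_gradient _ _ (fun v => - G x v) y y' _ (ccvG x)).
  apply: differentiableN.
  exact: (@differentiable_comp _ _ _ _ (fun v => (x, v)) (fun w : X * Y => G w.1 w.2 : R^o)).
- move=> x y x' y'; rewrite -!pair_norm_sqr -exprMn lerXn2r ?nnegrE ?mulr_ge0 ?sqrtr_ge0//.
Qed.

(** Monotonicity of the saddle operator [(gx, - gy)]: add the convexity and concavity inequalities
    between the two points, in both directions. *)
Lemma coupling_monotone G gx gy L2 x y x' y' : coupling G gx gy L2 ->
  0 <= dot (gx x y - gx x' y') (x - x') - dot (gy x y - gy x' y') (y - y').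
Proof.
case=> cvx ccv _.
have := cvx x y x'; have := cvx x' y' x; have := ccv x y y'; have := ccv x' y' y.
rewrite -(opprB x x') -(opprB y y') !dotE; lra.
Qed.

End oracle_facts.

(** * Saddle points of strongly convex-concave problems *)

(** Solvability of the proximal problems, in the form of their optimality condition; the oracle is
    the witness for it in [oracle_proxable]. *)
Definition proxable {R : realType} {d : nat} (phi : 'rV[R]_d -> R) (mu : R) :=
  forall a c xbar, 0 < c -> exists u, subgrad phi mu u (c *: (xbar - u) - a).

Lemma nsq_row_mx {R : realType} {d1 d2 : nat} (x : 'rV[R]_d1) (y : 'rV[R]_d2) :
  nsq (row_mx x y) = nsq x + nsq y.
Proof.
rewrite /nsq /dot big_split_ord/=; congr (_ + _); apply: eq_bigr => j _.
  by rewrite row_mxEl.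
by rewrite row_mxEr.
Qed.

(* The minimizer of [<a, x> + f x + beta / 2 |x - xc|^2 + c / 2 |x - z|^2]
   is the one of a single proximal problem. *)
Definition prox_center {R : realType} {d : nat} (c beta : R) (z xc : 'rV[R]_d) :=
  (c + beta)^-1 *: (c *: z + beta *: xc).

Lemma prox_centerE {R : realType} {d : nat} (c beta : R) (z xc u : 'rV[R]_d) :
  0 < c -> 0 <= beta ->
  (c + beta) *: (prox_center c beta z xc - u) = c *: (z - u) + beta *: (xc - u).
Proof.
move=> c0 b0; rewrite /prox_center; apply/rowP => j; rewrite !mxE; field.
by rewrite gt_eqF// ltr_wpDr.
Qed.

(** Strong monotonicity of the subgradients, then Young's inequality with weight [c]. The inner
    product is kept because its sign is known once [a] and [a'] are values of a monotone
    operator. *)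
Lemma prox_step_contract {R : realType} {d : nat} (phi : 'rV[R]_d -> R)
    (mu c beta : R) (xc z z' a a' u u' : 'rV[R]_d) : 0 < c -> 0 <= beta ->
  subgrad phi mu u (c *: (z - u) + beta *: (xc - u) - a) ->
  subgrad phi mu u' (c *: (z' - u') + beta *: (xc - u') - a') ->
  (c + 2 * mu) * nsq (u - u') <=
    c * nsq (z - z') + c^-1 * nsq (a - a') - 2 * dot (a - a') (z - z').
Proof.
move=> c0 b0 su su'; have := subgrad_mono su su'.
have -> : c *: (z - u) + beta *: (xc - u) - a - (c *: (z' - u') + beta *: (xc - u') - a')
  = (c *: (z - z') - (a - a')) - (c + beta) *: (u - u').
  by apply/rowP => j; rewrite !mxE; ring.
move: (u - u') (z - z') (a - a') => v w b.
have := young (c *: w - b) v c0; rewrite nsqD nsqN nsqZ !dotE -!/(nsq _) (dotC w b).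
have -> : c^-1 * (c ^+ 2 * nsq w + nsq b + 2 * - (c * dot b w)) =
  c * nsq w + c^-1 * nsq b - 2 * dot b w by field; rewrite gt_eqF.
by have := mulr_ge0 b0 (nsq_ge0 v) => ???; lra.
Qed.

Section saddle_existence.
Context {R : realType} {dx dy : nat}.
Notation X := 'rV[R]_dx.
Notation Y := 'rV[R]_dy.
Variables (f : X -> R) (h : Y -> R) (G : X -> Y -> R).
Variables (gx : X -> Y -> X) (gy : X -> Y -> Y) (mux muy L2 : R).
Hypotheses (mux0 : 0 < mux) (muy0 : 0 < muy) (L20 : 0 < L2).
Hypotheses (cG : coupling G gx gy L2) (pf : proxable f mux) (ph : proxable h muy).

(** Optimality conditions of the saddle problem with the extra term [beta / 2 |x - xc|^2]; the
    original problem is [beta = 0], whatever [xc]. *)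
Definition saddle_eq (beta : R) (xc : X) (x : X) (y : Y) :=
  subgrad f mux x (beta *: (xc - x) - gx x y) /\ subgrad h muy y (gy x y).

(** The saddle point is the fixed point of a forward-backward step of small size [1 / c], which
    contracts the joint squared distance. *)
Lemma saddle_exists beta xc : 0 <= beta -> exists x y, saddle_eq beta xc x y.
Proof.
move=> b0; pose mu := Num.min mux muy.
have mu0 : 0 < mu by rewrite lt_min mux0.
have mumux : mu <= mux by rewrite ge_min lexx.
have mumuy : mu <= muy by rewrite ge_min lexx orbT.
(* With [L2 = c * mu] the Lipschitz error [c^-1 * L2] equals [mu], while strong convexity gains
   [2 * mu]: the factor is [(c + mu) / (c + 2 * mu)]. *)
pose c := L2 / mu; have c0 : 0 < c by rewrite divr_gt0.
have cmu : L2 = c * mu by rewrite /c divfK ?gt_eqF.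
have /boolp.choice[px pxP] : forall z : X * Y, exists u,
    subgrad f mux u (c *: (z.1 - u) + beta *: (xc - u) - gx z.1 z.2).
  move=> z; have [|u uP] := pf (gx z.1 z.2) (prox_center c beta z.1 xc) (_ : 0 < c + beta).
    by rewrite ltr_wpDr.
  by exists u; rewrite -prox_centerE.
have /boolp.choice[py pyP] : forall z : X * Y, exists u,
    subgrad h muy u (c *: (z.2 - u) + gy z.1 z.2).
  move=> z; have [u uP] := ph (- gy z.1 z.2) z.2 c0.
  by exists u; rewrite opprK in uP.
pose T (z : 'rV[R]_(dx + dy)) :=
  let w := (lsubmx z, rsubmx z) in row_mx (px w) (py w).
have contr z z' : nsq (px z - px z') + nsq (py z - py z') <=
    (c + mu) / (c + 2 * mu) * (nsq (z.1 - z'.1) + nsq (z.2 - z'.2)).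
  have := prox_step_contract c0 b0 (pxP z) (pxP z').
  have pyP0 w : subgrad h muy (py w) (c *: (w.2 - py w) + 0 *: (0 - py w) - - gy w.1 w.2).
    by rewrite scale0r addr0 opprK.
  have := prox_step_contract c0 (lexx 0) (pyP0 z) (pyP0 z').
  rewrite -opprD !(dotNl (gy _ _ - _)) nsqN.
  have mono := coupling_monotone z.1 z.2 z'.1 z'.2 cG.
  have := coupling_lipschitz cG z.1 z.2 z'.1 z'.2.
  rewrite cmu -mulrA -ler_pdivrMl// => lip h2 h1.
  rewrite mulrAC ler_pdivlMr; last by lra.
  have := nsq_ge0 (px z - px z'); have := nsq_ge0 (py z - py z').
  by nra.
have [||z zE] := @euclidean_banach R _ T ((c + mu) / (c + 2 * mu)).
- apply/andP; split; first by apply: divr_ge0; lra.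
  by rewrite ltr_pdivrMr; lra.
- move=> z z'; rewrite /T/= opp_row_mx add_row_mx nsq_row_mx.
  by rewrite (le_trans (contr _ _))//= -[z - z']hsubmxK nsq_row_mx !linearB.
exists (lsubmx z), (rsubmx z); split.
  have := pxP (lsubmx z, rsubmx z); rewrite /=.
  have -> : px (lsubmx z, rsubmx z) = lsubmx z by rewrite -[RHS]/(lsubmx z) -{3}zE row_mxKl.
  by rewrite subrr scaler0 add0r.
have := pyP (lsubmx z, rsubmx z); rewrite /=.
have -> : py (lsubmx z, rsubmx z) = rsubmx z by rewrite -{3}zE row_mxKr.
by rewrite subrr scaler0 add0r.
Qed.
End saddle_existence.

Section saddle_consequences.
Context {R : realType} {dx dy : nat}.
Notation X := 'rV[R]_dx.
Notation Y := 'rV[R]_dy.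
Variables (f : X -> R) (h : Y -> R) (G : X -> Y -> R).
Variables (gx : X -> Y -> X) (gy : X -> Y -> Y) (mux muy : R).

Lemma saddle_eq_min L2 beta xc x y x' : coupling G gx gy L2 ->
  saddle_eq f h gx gy mux muy beta xc x y ->
  f x + G x y + beta / 2 * nsq (x - xc) + (mux + beta) / 2 * nsq (x' - x)
    <= f x' + G x' y + beta / 2 * nsq (x' - xc).
Proof.
move=> cG [/(_ x') + _]; have := coupling_convex cG x y x'.
have -> : x' - xc = (x' - x) + (x - xc) by rewrite addrA subrK.
rewrite -(opprB x xc); move: (x' - x) (x - xc) => v w.
by rewrite nsqD !dotE (dotC v w); lra.
Qed.

Lemma saddle_eq_max L2 beta xc x y y' : coupling G gx gy L2 ->
  saddle_eq f h gx gy mux muy beta xc x y ->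
  G x y' - h y' + muy / 2 * nsq (y' - y) <= G x y - h y.
Proof. by move=> cG [_ /(_ y')]; have := coupling_concave cG x y y'; lra. Qed.

Lemma saddle_eq_saddle_point L2 xc x y : coupling G gx gy L2 -> 0 < mux -> 0 < muy ->
  saddle_eq f h gx gy mux muy 0 xc x y -> saddle_point f h G x y.
Proof.
move=> cG mux0 muy0 xyP x' y'; rewrite /objective.
have := saddle_eq_max y' cG xyP; have := saddle_eq_min x' cG xyP.
have := nsq_ge0 (x' - x); have := nsq_ge0 (y' - y).
by split; nra.
Qed.

End saddle_consequences.

(** * Attainment of the duality gap and effect of one proximal gradient step *)

Section coupled.
Context {R : realType} {dx dy : nat}.
Notation X := 'rV[R]_dx.
Notation Y := 'rV[R]_dy.
Variables (f : X -> R) (h : Y -> R) (G : X -> Y -> R).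
Variables (gx : X -> Y -> X) (gy : X -> Y -> Y) (mux muy L : R).
Hypotheses (mux0 : 0 < mux) (muxy : mux <= muy) (muL : muy <= L).
Hypotheses (cG : coupling G gx gy (L ^+ 2)) (pf : proxable f mux) (ph : proxable h muy).

Let muy0 : 0 < muy. Proof. exact: lt_le_trans muxy. Qed.
Let L0 : 0 < L. Proof. exact: lt_le_trans muL. Qed.
Let L20 : 0 < L ^+ 2. Proof. by rewrite exprn_gt0. Qed.

Let saddle_eq := saddle_eq f h gx gy mux muy.

(* Freezing one argument of the coupling turns the existence of saddle points
   into that of maximizers and minimizers. *)
Lemma max_attained x : exists M, is_max [set objective f h G x y | y in setT] M.
Proof.
have cG' : coupling (fun (_ : X) y => G x y) (fun _ _ => 0) (fun _ y => gy x y) (L ^+ 2).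
  split=> [x1 y x2|x1 y y'|x1 y x2 y'] /=; first by rewrite dot0l addr0.
    exact: (coupling_concave cG).
  rewrite subrr nsq0 add0r.
  have := coupling_lipschitz cG x y x y'; rewrite !subrr nsq0 add0r.
  have := nsq_ge0 (gx x y - gx x y').
  by have := mulr_ge0 (ltW L20) (nsq_ge0 (x1 - x2)); lra.
have [x1 [y xyP]] := saddle_exists mux0 muy0 L20 cG' pf ph 0 (lexx 0).
exists (objective f h G x y); split; first by exists y.
move=> _ [y' _ <-]; have := saddle_eq_max y' cG' xyP; rewrite /objective /=.
by have := mulr_ge0 (ltW muy0) (nsq_ge0 (y' - y)); lra.
Qed.

Lemma min_attained y : exists m, is_min [set objective f h G x y | x in setT] m.
Proof.
have cG' : coupling (fun x (_ : Y) => G x y) (fun x _ => gx x y) (fun _ _ => 0) (L ^+ 2).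
  split=> [x1 y1 x2|x1 y1 y'|x1 y1 x2 y'] /=; last first.
  - rewrite subrr nsq0 addr0.
    have := coupling_lipschitz cG x1 y x2 y; rewrite !subrr nsq0 addr0.
    have := nsq_ge0 (gy x1 y - gy x2 y).
    by have := mulr_ge0 (ltW L20) (nsq_ge0 (y1 - y')); lra.
  - by rewrite dot0l addr0.
  - exact: (coupling_convex cG).
have [x [y1 xyP]] := saddle_exists mux0 muy0 L20 cG' pf ph 0 (lexx 0).
exists (objective f h G x y); split; first by exists x.
move=> _ [x' _ <-]; have := saddle_eq_min x' cG' xyP; rewrite /objective /=.
by have := mulr_ge0 (ltW mux0) (nsq_ge0 (x' - x)); lra.
Qed.

(** Optimality conditions of a forward-backward step of size [1 / L] from [(x, y)] to [(x', y')]. *)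
Definition prox_grad (x : X) (y : Y) (x' : X) (y' : Y) :=
  subgrad f mux x' (L *: (x - x') - gx x y) /\
  subgrad h muy y' (L *: (y - y') + gy x y).

Variables (xs : X) (ys : Y).
Hypothesis saddle : saddle_eq 0 0 xs ys.

Section one_step.
Variables (x x' : X) (y y' : Y).
Hypothesis step : prox_grad x y x' y'.

(** [rx] and [ry] are the residuals of the step: what is left in the optimality conditions of the
    saddle problem at [(x', y')]. *)
Let rx := gx x' y' - gx x y + L *: (x - x').
Let ry := gy x y - gy x' y' + L *: (y - y').

Let residual_le : nsq rx + nsq ry <= 4 * L ^+ 2 * (nsq (x - x') + nsq (y - y')).
Proof.
have := coupling_lipschitz cG x' y' x y; rewrite (nsqBC x') (nsqBC y') (nsqBC (gy _ _)).
have := nsqD_le (gx x' y' - gx x y) (L *: (x - x')).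
have := nsqD_le (gy x y - gy x' y') (L *: (y - y')).
by rewrite -/rx -/ry !nsqZ; lra.
Qed.

(** With [c = L] the Lipschitz error is [L^2 / L = L], so the step may expand squared distances, but
    at most by [(L + L) / L = 2]. *)
Lemma prox_grad_contract :
  nsq (x' - xs) + nsq (y' - ys) <= 2 * (nsq (x - xs) + nsq (y - ys)).
Proof.
case: step saddle => sx sy [sxs sys].
have := @prox_step_contract _ _ f mux L 0 0 x xs (gx x y) (gx xs ys) x' xs L0 (lexx 0).
rewrite !scale0r !addr0 subrr scaler0 => /(_ sx).
rewrite scale0r in sxs => /(_ sxs).
have := @prox_step_contract _ _ h muy L 0 0 y ys (- gy x y) (- gy xs ys) y' ys L0 (lexx 0).
rewrite !scale0r !addr0 subrr scaler0 !opprK => /(_ sy); rewrite add0r => /(_ sys).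
rewrite (_ : - gy x y + gy xs ys = - (gy x y - gy xs ys)); last by rewrite opprB addrC.
rewrite !(dotNl (gy _ _ - _)) nsqN.
have := coupling_monotone x y xs ys cG; have := coupling_lipschitz cG x y xs ys.
rewrite expr2 -mulrA -ler_pdivrMl// mulrDr.
have := mulr_ge0 (ltW mux0) (nsq_ge0 (x' - xs)).
have := mulr_ge0 (ltW muy0) (nsq_ge0 (y' - ys)).
by move=> *; rewrite -(ler_pM2l L0); lra.
Qed.

Lemma prox_grad_move :
  nsq (x - x') + nsq (y - y') <= 6 * (nsq (x - xs) + nsq (y - ys)).
Proof.
have := prox_grad_contract.
have := nsqD_le (x - xs) (xs - x'); have := nsqD_le (y - ys) (ys - y').
by rewrite !addrA !subrK (nsqBC xs) (nsqBC ys); lra.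
Qed.

(** Strong monotonicity bounds the distance from [(x', y')] to the saddle point by the residual over
    [mux], and the residual is at most [2 L] times the step length. The triangle inequality gives
    [2 + 8 (L / mux)^2], and [mux <= L] turns this into 10. *)
Lemma prox_grad_error_bound :
  nsq (x - xs) + nsq (y - ys) <= 10 * (L / mux) ^+ 2 * (nsq (x - x') + nsq (y - y')).
Proof.
case: step saddle => sx sy [sxs sys].
have err : mux ^+ 2 * (nsq (x' - xs) + nsq (y' - ys)) <= nsq rx + nsq ry.
  have := subgrad_mono sx sxs; have := subgrad_mono sy sys.
  have := coupling_monotone x' y' xs ys cG.
  have := young rx (x' - xs) mux0; have := young ry (y' - ys) mux0.
  have := ler_wpM2r (nsq_ge0 (y' - ys)) muxy.
  rewrite scale0r sub0r opprK.
  have -> : L *: (x - x') - gx x y + gx xs ys = rx - (gx x' y' - gx xs ys).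
    by rewrite /rx; apply/rowP => j; rewrite !mxE; ring.
  have -> : L *: (y - y') + gy x y - gy xs ys = ry + (gy x' y' - gy xs ys).
    by rewrite /ry; apply/rowP => j; rewrite !mxE; ring.
  rewrite (dotDl rx) (dotDl ry) dotNl => *.
  rewrite expr2 -mulrA -ler_pdivlMl//; lra.
have := residual_le; move: err.
rewrite exprMn exprVn (mulrA 10) => e1 e2.
have := nsqD_le (x - x') (x' - xs); have := nsqD_le (y - y') (y' - ys).
rewrite !addrA !subrK.
have /le_trans/(_ e2) := e1; rewrite -ler_pdivlMl ?exprn_gt0// => e3.
have muxL : 1 <= L ^+ 2 / mux ^+ 2.
  by rewrite ler_pdivlMr ?exprn_gt0// mul1r lerXn2r ?nnegrE ?(ltW mux0) ?(ltW L0)// (le_trans muxy).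
have := addr_ge0 (nsq_ge0 (x - x')) (nsq_ge0 (y - y')).
move: muxL e3; have -> (a : R) : (mux ^+ 2)^-1 * (4 * L ^+ 2 * a) = 4 * (L ^+ 2 / mux ^+ 2) * a by ring.
have -> (a : R) : 10 * L ^+ 2 * (mux ^- 2) * a = 10 * (L ^+ 2 / mux ^+ 2) * a by ring.
by move: (L ^+ 2 / mux ^+ 2) => q *; nra.
Qed.

(** Strong convexity absorbs the linear residual terms, so the gap is at most
    [(nsq rx + nsq ry) / (2 mux)]. The constant is [12 = 4 * 6 / 2], from [residual_le] and
    [prox_grad_move]. *)
Lemma prox_grad_eps_solution eps :
  12 * L ^+ 2 / mux * (nsq (x - xs) + nsq (y - ys)) <= eps ->
  eps_solution f h G eps (x', y').
Proof.
move=> small; have [M maxM] := max_attained x'; have [m minm] := min_attained y'.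
exists M, m; split=> //=; apply: le_trans small.
case: maxM minm => -[yM _ <-] _ [[xm _ <-] _]; rewrite /objective.
case: step => /(_ xm) sx /(_ yM) sy.
have gapx : f x' + G x' y' - (2 * mux)^-1 * nsq rx <= f xm + G xm y'.
  have := coupling_convex cG x' y' xm; have := young (- rx) (xm - x') mux0.
  rewrite nsqN invfM; move: sx (nsq rx) => + n; rewrite /rx !dotE; lra.
have gapy : G x' yM - h yM - (2 * muy)^-1 * nsq ry <= G x' y' - h y'.
  have := coupling_concave cG x' y' yM; have := young (- ry) (yM - y') muy0.
  rewrite nsqN invfM; move: sy (nsq ry) => + n; rewrite /ry !dotE; lra.
have : (2 * muy)^-1 * nsq ry <= (2 * mux)^-1 * nsq ry.
  by rewrite ler_wpM2r ?nsq_ge0// lef_pV2 ?posrE ?mulr_gt0// ler_pM2l.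
have k0 : 0 <= (2 * mux)^-1 by rewrite invr_ge0 mulr_ge0// ltW.
have k1 : 0 <= 2 * L ^+ 2 / mux by rewrite divr_ge0 ?mulr_ge0// ltW.
have := ler_wpM2l k0 residual_le; have := ler_wpM2l k1 prox_grad_move.
by move: gapx gapy; rewrite invfM; lra.
Qed.

End one_step.
End coupled.

(** * Accelerated proximal point method *)

Section moreau.
Context {R : realType} {dx dy : nat}.
Notation X := 'rV[R]_dx.
Notation Y := 'rV[R]_dy.
Variables (f : X -> R) (h : Y -> R) (G : X -> Y -> R).
Variables (gx : X -> Y -> X) (gy : X -> Y -> Y) (mux muy L2 : R).
Hypotheses (mux0 : 0 < mux) (muxy : mux <= muy).
Hypothesis cG : coupling G gx gy L2.

Let muy0 : 0 < muy. Proof. exact: lt_le_trans muxy. Qed.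

(* When [(p, v)] is the saddle point of the problem regularized at [c], this is
   the value at [c] of the Moreau envelope of the primal function
   [x |-> max_y (f x + G x y - h y)]. *)
Definition envelope (c p : X) (v : Y) := objective f h G p v + muy / 2 * nsq (p - c).

Notation regularized_saddle := (saddle_eq f h gx gy mux muy muy).

(** The added quadratic has zero gradient at its center, so the saddle point is its own proximal
    point and the gradient of the envelope vanishes there. *)
Lemma saddle_eq_center xs ys : saddle_eq f h gx gy mux muy 0 0 xs ys ->
  regularized_saddle xs xs ys.
Proof. by rewrite /saddle_eq subrr scale0r scaler0. Qed.

(** The old proximal point [p] competes in the minimization at [c'], and the new [v'] in the
    maximization at [c]. *)
Lemma envelope_upper c p v c' p' v' :
  regularized_saddle c p v -> regularized_saddle c' p' v' ->
  envelope c' p' v' <=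
    envelope c p v + muy * dot (c - p) (c' - c) + muy / 2 * nsq (c' - c).
Proof.
move=> cS cS'; have := saddle_eq_min p cG cS'; have := saddle_eq_max v' cG cS.
rewrite /envelope /objective.
have -> : p - c' = - ((c - p) + (c' - c)) by apply/rowP => j; rewrite !mxE; ring.
rewrite nsqN (nsqD (c - p)) (nsqBC p c).
have := mulr_ge0 (ltW muy0) (nsq_ge0 (v' - v)).
have := mulr_ge0 (ltW muy0) (nsq_ge0 (p - p')).
have := mulr_ge0 (ltW mux0) (nsq_ge0 (p - p')).
by lra.
Qed.

(** The competitors of [envelope_upper] with the roles of [c] and [c'] exchanged; now the quadratic
    growth around [p] is kept. *)
Lemma envelope_lower c p v c' p' v' :
  regularized_saddle c p v -> regularized_saddle c' p' v' ->
  envelope c p v + muy * dot (c - p) (c' - c) + mux / 4 * nsq (c' - c)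
    <= envelope c' p' v'.
Proof.
move=> cS cS'; have := saddle_eq_min p' cG cS; have := saddle_eq_max v cG cS'.
have -> : p' - c = (p' - p) - (c - p) by apply/rowP => j; rewrite !mxE; ring.
rewrite /envelope /objective.
have -> : p' - c' = (p' - p) - (c - p) - (c' - c) by apply/rowP => j; rewrite !mxE; ring.
rewrite (nsqBC p c).
have := mulr_ge0 (ltW muy0) (nsq_ge0 (v - v')).
move: (p' - p) (c - p) (c' - c) => q e w.
(* This weight makes Young's inequality consume exactly the growth [(mux + muy) / 2 |q|^2]. The
   modulus left over is [mux * muy / (mux + muy)], at least [mux / 2] because [mux <= muy]. *)
have k0 : 0 < (mux + muy) / muy by rewrite divr_gt0 ?addr_gt0.
have /(ler_wpM2l (ltW muy0)) := young w q k0.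
have -> : muy * (((mux + muy) / muy)^-1 * nsq w + (mux + muy) / muy * nsq q) =
  muy ^+ 2 / (mux + muy) * nsq w + (mux + muy) * nsq q.
  by field; rewrite !gt_eqF ?addr_gt0.
have : muy ^+ 2 / (mux + muy) <= muy - mux / 2.
  rewrite ler_pdivrMr ?addr_gt0//.
  by have := ler_wpM2l (ltW mux0) muxy; lra.
move=> /(ler_wpM2r (nsq_ge0 w)).
rewrite (nsqD (q - e)) !nsqN !dotE (dotC w q) (dotC e w); move: (nsq (q - e)) => s.
lra.
Qed.

(** Firm nonexpansiveness of the proximal map at its fixed point [xs]; strong concavity adds the
    distance of the dual points. *)
Lemma regularized_saddle_dist c p v xs ys :
  regularized_saddle c p v -> saddle_eq f h gx gy mux muy 0 0 xs ys ->
  nsq (c - p) + nsq (p - xs) + 2 * nsq (v - ys) <= nsq (c - xs).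
Proof.
move=> [sp sv] [sxs sys]; have := subgrad_mono sp sxs; have := subgrad_mono sv sys.
have := coupling_monotone p v xs ys cG.
have -> : muy *: (c - p) - gx p v - (0 *: (0 - xs) - gx xs ys) =
    muy *: (c - p) - (gx p v - gx xs ys) by apply/rowP => j; rewrite !mxE; ring.
rewrite (dotDl (muy *: _)) dotNl dotZl.
have -> : c - xs = (c - p) + (p - xs) by rewrite addrA subrK.
rewrite (nsqD (c - p)) => m1 m2 m3.
have := mulr_ge0 (ltW mux0) (nsq_ge0 (p - xs)) => m4.
by rewrite -(ler_pM2l muy0); lra.
Qed.

End moreau.

(* One step of Nesterov's method with gradient [muy *: (y - p)] and an error
   [p - p'] on the proximal point [p]. *)
Lemma accelerated_step (R : realType) (d : nat) (a muy : R) (x v y v' p p' xs : 'rV[R]_d)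
    (Mx My Mp Ms : R) :
  0 < a -> a <= 1 -> 0 < muy -> y = (1 + a)^-1 *: (x + a *: v) ->
  v' = (1 - a) *: v + a *: y - a^-1 *: (y - p') ->
  My + muy * dot (y - p) (x - y) <= Mx ->
  My + muy * dot (y - p) (xs - y) + a ^+ 2 * muy / 2 * nsq (xs - y) <= Ms ->
  Mp <= My + muy * dot (y - p) (p' - y) + muy / 2 * nsq (p' - y) ->
  Ms <= My - muy / 2 * nsq (y - p) -> Ms <= Mx ->
  Mp - Ms + a ^+ 2 * muy / 2 * nsq (v' - xs) <=
    (1 - a / 2) * (Mx - Ms + a ^+ 2 * muy / 2 * nsq (v - xs))
    + muy * (1 + a^-1) * nsq (p' - p).
Proof.
move=> a0 a1 muy0 yE vE' H1 H2 H3 H4 H5.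
have a10 : 1 + a != 0 by rewrite gt_eqF// addr_gt0.
have an0 : a != 0 by rewrite gt_eqF.
have xyE : x - y = a *: ((y - xs) - (v - xs)).
  by rewrite yE; apply/rowP => j; rewrite !mxE; field.
pose w := (1 - a) *: (v - xs) + (1 - (1 - a)) *: (y - xs).
(* The update splits into the one with the exact proximal point and the error [p' - p]. *)
have vE : v' - xs = (w - a^-1 *: (y - p)) + a^-1 *: (p' - p).
  by rewrite vE' /w; apply/rowP => j; rewrite !mxE; field.
have pyE : p' - y = (p' - p) - (y - p) by rewrite opprB addrA subrK.
have a01 : 0 <= 1 - a <= 1 by apply/andP; split; lra.
have wle := nsq_convex (v - xs) (y - xs) a01; rewrite -/w in wle.
have wE : dot w (y - p) = (1 - a) * dot (v - xs) (y - p) + a * dot (y - xs) (y - p).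
  by rewrite /w !(dotDl (_ *: _)) !(dotZl _ (_ - _)); ring.
have k0 : 0 < a / 2 by rewrite divr_gt0.
(* The weight [a / 2] charges the cross term to a fraction [a / 2] of the energy of the exact update
   and to [muy / a] times the squared error. *)
have := young (p' - p) (a *: (w - a^-1 *: (y - p))) k0.
clearbody w.
move: H1 H2 H3 H4 wle wE; rewrite xyE vE pyE -(opprB y xs) nsqN.
clear vE xyE pyE yE vE'; move: (y - p) (y - xs) (v - xs) (p' - p) => D W V E.
rewrite dotNr dotZr (dotDr W) (dotDr E) !dotNr (nsqD E) nsqN dotNr.
rewrite (dotC V) (dotC W) => H1 H2 H3 H4 wle wE.
rewrite (nsqD (w - _)) !nsqZ !dotZr.
have := nsqD w (- (a^-1 *: D)); rewrite dotNr dotZr nsqN nsqZ wE.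
have := nsq_ge0 (w - a^-1 *: D).
move: (w - a^-1 *: D) => u B0 BE yng; rewrite -/(nsq D) (dotC E D) in H3; rewrite (dotC E u) in yng.
have {}BE : a ^+ 2 * muy / 2 * nsq u =
    a ^+ 2 * muy / 2 * nsq w + muy / 2 * nsq D
    - a * muy * ((1 - a) * dot D V + a * dot D W).
  by rewrite BE; field.
have {}B0 : 0 <= a ^+ 2 * muy / 2 * nsq u.
  by rewrite mulr_ge0// divr_ge0// mulr_ge0 ?sqr_ge0// ltW.
have {}yng : a * muy * dot u E <= muy * a^-1 * nsq E + a / 2 * (a ^+ 2 * muy / 2 * nsq u).
  have := ler_wpM2l (ltW muy0) yng.
  have -> : muy * ((a / 2)^-1 * nsq E + a / 2 * (a ^+ 2 * nsq u)) =
    2 * (muy * a^-1 * nsq E + a / 2 * (a ^+ 2 * muy / 2 * nsq u)) by field.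
  lra.
have a1' : 0 <= 1 - a by rewrite subr_ge0.
have {}wle : a ^+ 2 * muy / 2 * nsq w <=
    a ^+ 2 * muy / 2 * ((1 - a) * nsq V + (1 - (1 - a)) * nsq W).
  by rewrite ler_wpM2l// divr_ge0// mulr_ge0 ?sqr_ge0// ltW.
have -> : a ^+ 2 * muy / 2 * (nsq u + a^-1 ^+ 2 * nsq E + 2 * (a^-1 * dot u E)) =
  a ^+ 2 * muy / 2 * nsq u + muy / 2 * nsq E + a * muy * dot u E by field.
have -> : muy * (1 + a^-1) * nsq E = muy * nsq E + muy * a^-1 * nsq E by ring.
move: (a ^+ 2 * muy / 2 * nsq u) BE B0 yng => B BE B0 yng.
have {}H1 := ler_wpM2l a1' H1; have {}H2 := ler_wpM2l (ltW a0) H2.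
have V0 : 0 <= a ^+ 2 * muy / 2 * nsq V.
  by rewrite mulr_ge0 ?nsq_ge0// divr_ge0// mulr_ge0 ?sqr_ge0// ltW.
have AB : My - muy / 2 * nsq D - Ms + B <=
  (1 - a) * (Mx - Ms + a ^+ 2 * muy / 2 * nsq V) by lra.
have {}H3 : Mp <= My - muy / 2 * nsq D + muy / 2 * nsq E by lra.
have Q0 : 0 <= Mx - Ms + a ^+ 2 * muy / 2 * nsq V by rewrite addr_ge0// subr_ge0.
clear wle wE H1 H2 BE V0; move: (Mx - Ms + _) (My - muy / 2 * nsq D) AB H3 H4 Q0 => Q A AB H3 H4 Q0.
(* The exact step contracts by [1 - a], and [(1 + a / 2) (1 - a) <= 1 - a / 2]: inexactness costs
   half of the rate. *)
have a2 : 0 <= 1 + a / 2 by lra.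
have := ler_wpM2l a2 AB; have := mulr_ge0 (sqr_ge0 a) Q0.
have : 0 <= a / 2 * (A - Ms) by rewrite mulr_ge0 ?subr_ge0// ltW.
lra.
Qed.

(** * Programs and their expectations *)

Lemma weighted_affine (R : realType) (n : nat) (p : fin_dist R n) (s t : R) (B : 'I_n -> R) :
  \sum_(i < n) p i * (s * B i + t) = s * (\sum_(i < n) p i * B i) + t.
Proof.
under eq_bigr do rewrite mulrDr mulrCA.
by rewrite big_split -mulr_sumr -mulr_suml weight_sum1 mul1r.
Qed.

Section programs.
Context {R : realType} {dx dy m : nat}.
Notation X := 'rV[R]_dx.
Notation Y := 'rV[R]_dy.
Notation algorithm := (algorithm R dx dy m).
Notation oracle := (oracle R dx dy m).
Implicit Types (a : algorithm) (O : oracle) (k : X -> Y -> algorithm) (phi psi : X -> Y -> R).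

Fixpoint bind a k : algorithm :=
  match a with
  | Return x y => k x y
  | @Call _ _ _ _ c q k' => Call q (fun r => bind (k' r) k)
  | @Draw _ _ _ _ n p k' => Draw p (fun i => bind (k' i) k)
  end.

Fixpoint expect O phi a : R :=
  match a with
  | Return x y => phi x y
  | @Call _ _ _ _ c q k' => expect O phi (k' (O c q))
  | @Draw _ _ _ _ n p k' => \sum_(i < n) p i * expect O phi (k' i)
  end.

Lemma prob_outputE O A a : prob_output O A a = expect O (fun x y => \1_A (x, y)) a.
Proof. by elim: a => //= n p k IH; apply: eq_bigr => i _; rewrite IH. Qed.

Lemma expect_bind O phi a k :
  expect O phi (bind a k) = expect O (fun x y => expect O phi (k x y)) a.
Proof. by elim: a => //= n p k' IH; apply: eq_bigr => i _; rewrite IH. Qed.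

Lemma expect_le O phi psi a : (forall x y, phi x y <= psi x y) ->
  expect O phi a <= expect O psi a.
Proof.
move=> phipsi; elim: a => //= n p k IH.
by apply: ler_sum => i _; rewrite ler_wpM2l ?weight_ge0.
Qed.

Lemma expect_affine O phi a (s t : R) :
  expect O (fun x y => s * phi x y + t) a = s * expect O phi a + t.
Proof.
by elim: a => //= n p k IH; under eq_bigr do rewrite IH; rewrite weighted_affine.
Qed.

Lemma max_calls_bind O c a k n : (forall x y, max_calls O c (k x y) <= n)%N ->
  (max_calls O c (bind a k) <= max_calls O c a + n)%N.
Proof.
move=> kn; elim: a => //= [c' q k' IH|r p k' IH]; first by rewrite -addnA leq_add2l.
apply/bigmax_leqP => i _; apply: leq_trans (IH i) _.
by rewrite leq_add2r (leq_bigmax (F := fun j => max_calls O c (k' j))).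
Qed.

Definition mean_gradx O x y : X := m%:R^-1 *: \sum_(i < m) O GradX (i, x, y).
Definition mean_grady O x y : Y := m%:R^-1 *: \sum_(i < m) O GradY (i, x, y).

Fixpoint sum_gradients (s : seq 'I_m) (x u : X) (y v : Y) k : algorithm :=
  if s is i :: s' then
    @Call _ _ _ _ GradX (i, x, y) (fun gx =>
    @Call _ _ _ _ GradY (i, x, y) (fun gy =>
    sum_gradients s' x (u + gx) y (v + gy) k))
  else k u v.

Definition with_gradient x y k :=
  sum_gradients (enum 'I_m) x 0 y 0 (fun u v => k (m%:R^-1 *: u) (m%:R^-1 *: v)).

Lemma expect_sum_gradients O phi s x u y v k :
  expect O phi (sum_gradients s x u y v k) =
  expect O phi (k (u + \sum_(i <- s) O GradX (i, x, y)) (v + \sum_(i <- s) O GradY (i, x, y))).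
Proof.
elim: s u v => [|i s IH] u v /=; first by rewrite !big_nil !addr0.
by rewrite IH !big_cons !addrA.
Qed.

Lemma max_calls_sum_gradients O c s x u y v k :
  (max_calls O c (sum_gradients s x u y v k) <= size s +
  max_calls O c (k (u + \sum_(i <- s) O GradX (i, x, y))%R
                   (v + \sum_(i <- s) O GradY (i, x, y))%R))%N.
Proof.
elim: s u v => [|i s IH] u v /=; first by rewrite !big_nil !addr0.
(* Calls are counted for each kind separately, so a pair of partial gradients costs one. *)
have c1 : (`[< GradX = c >] + `[< GradY = c >] <= 1)%N.
  by case: asboolP => [<-|]; case: asboolP.
by rewrite addnA (leq_trans (leq_add c1 (IH _ _)))// !big_cons !addrA.
Qed.

Lemma expect_with_gradient O phi x y k :
  expect O phi (with_gradient x y k) = expect O phi (k (mean_gradx O x y) (mean_grady O x y)).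
Proof. by rewrite expect_sum_gradients !add0r !big_enum. Qed.

Lemma max_calls_with_gradient O c x y k :
  (max_calls O c (with_gradient x y k) <=
    m + max_calls O c (k (mean_gradx O x y) (mean_grady O x y)))%N.
Proof.
apply: leq_trans (max_calls_sum_gradients _ _ _ _ _ _ _ _) _.
by rewrite size_enum_ord !add0r !big_enum.
Qed.

End programs.

(** * Importance sampling of the coupling terms *)

Section sampling.
Context {R : realType} {m : nat}.
Variable L : 'I_m -> R.
Hypotheses (L0 : forall i, 0 <= L i) (aL0 : 0 < average L).

Lemma average_gt0_card : 1 <= m%:R :> R.
Proof.
rewrite (ler_nat R 1 m) lt0n; apply: contraTneq aL0 => m0.
by rewrite /average [m%:R](_ : _ = 0) ?invr0 ?mul0r ?ltxx// m0.
Qed.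

Let m0 : 0 < m%:R :> R. Proof. exact: lt_le_trans average_gt0_card. Qed.

Definition sampling_weight i := L i / (m%:R * average L).

Lemma sampling_weight_ge0 i : 0 <= sampling_weight i.
Proof. by rewrite divr_ge0// mulr_ge0// ltW. Qed.

Lemma sampling_weight_sum1 : \sum_(i < m) sampling_weight i = 1.
Proof.
rewrite -mulr_suml /average mulrA mulfV ?gt_eqF// mul1r mulfV//.
apply: contraTneq aL0 => sL0.
by rewrite /average sL0 mulr0 ltxx.
Qed.

Definition sampling := FinDist sampling_weight_ge0 sampling_weight_sum1.

(* [sampling i * rescale i = 1 / m] unless [L i = 0], in which case both factors
   vanish and the gradient of the [i]-th term is constant. *)
Definition rescale i := average L / L i.

Lemma sampling_rescale d (v : 'I_m -> 'rV[R]_d) : (forall i, L i = 0 -> v i = 0) ->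
  \sum_(i < m) sampling i *: (rescale i *: v i) = m%:R^-1 *: \sum_(i < m) v i.
Proof.
move=> v0; rewrite scaler_sumr; apply: eq_bigr => i _; rewrite scalerA.
have [Li0|Li0] := eqVneq (L i) 0; first by rewrite v0// !scaler0.
congr (_ *: _); rewrite /= /sampling_weight /rescale; field.
by rewrite Li0 !gt_eqF.
Qed.

Lemma rescale_lipschitz i : (rescale i * L i) ^+ 2 <= average L ^+ 2.
Proof.
have [Li0|Li0] := eqVneq (L i) 0; first by rewrite Li0 mulr0 expr0n sqr_ge0.
by rewrite divfK.
Qed.

(** Jensen's inequality, from the nonnegativity of the variance around the mean [w]. *)
Lemma nsq_mean d (v : 'I_m -> 'rV[R]_d) :
  nsq (\sum_(i < m) sampling i *: v i) <= \sum_(i < m) sampling i * nsq (v i).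
Proof.
set w := \sum_(i < m) _.
have : 0 <= \sum_(i < m) sampling i * nsq (v i - w).
  by apply: sumr_ge0 => i _; rewrite mulr_ge0 ?nsq_ge0 ?weight_ge0.
under eq_bigr do rewrite nsqD nsqN dotNr mulrDr mulrDr.
rewrite !big_split/= -mulr_suml sampling_weight_sum1 mul1r.
have -> : \sum_(i < m) sampling i * (2 * - dot (v i) w) = - (2 * nsq w).
  rewrite /nsq {2}/w.
  elim/big_ind2: _ => [|a b a' b' -> ->|i _]; first by rewrite dot0l mulr0 oppr0.
    by rewrite dotDl; ring.
  by rewrite dotZl; ring.
by lra.
Qed.

End sampling.

Section average_coupling.
Context {R : realType} {dx dy m : nat}.
Notation X := 'rV[R]_dx.
Notation Y := 'rV[R]_dy.
Variables (L : 'I_m -> R) (Gi : 'I_m -> X -> Y -> R).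
Variables (gx : 'I_m -> X -> Y -> X) (gy : 'I_m -> X -> Y -> Y).
Hypotheses (L0 : forall i, 0 <= L i) (aL0 : 0 < average L).
Hypothesis cG : forall i, coupling (Gi i) (gx i) (gy i) (L i ^+ 2).

Lemma coupling_const i x y x' y' : L i = 0 ->
  gx i x y - gx i x' y' = 0 /\ gy i x y - gy i x' y' = 0.
Proof.
move=> Li0; have := coupling_lipschitz (cG i) x y x' y'; rewrite Li0 expr0n mul0r.
have := nsq_ge0 (gx i x y - gx i x' y'); have := nsq_ge0 (gy i x y - gy i x' y').
by split; apply: nsq_eq0; lra.
Qed.

(** The purpose of importance sampling: all rescaled differences obey the same constant [average L],
    however unequal the [L i] are. *)
Lemma rescaled_lipschitz i x y x' y' :
  nsq (rescale L i *: (gx i x y - gx i x' y')) + nsq (rescale L i *: (gy i x y - gy i x' y'))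
    <= average L ^+ 2 * (nsq (x - x') + nsq (y - y')).
Proof.
rewrite !nsqZ -mulrDr.
apply: le_trans (ler_wpM2l (sqr_ge0 _) (coupling_lipschitz (cG i) _ _ _ _)) _.
by rewrite mulrA -exprMn ler_wpM2r ?rescale_lipschitz// addr_ge0 ?nsq_ge0.
Qed.

(** For the Lipschitz bound, the mean of the differences is the expectation under [sampling] of the
    rescaled ones, so [nsq_mean] applies. *)
Lemma average_coupling : coupling (fun x y => average (fun i => Gi i x y))
  (fun x y => m%:R^-1 *: \sum_(i < m) gx i x y) (fun x y => m%:R^-1 *: \sum_(i < m) gy i x y)
  (average L ^+ 2).
Proof.
have m0 : 0 <= m%:R^-1 :> R by rewrite invr_ge0.
have dot_suml d (v : 'I_m -> 'rV[R]_d) w : dot (\sum_i v i) w = \sum_i dot (v i) w.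
  by elim/big_ind2: _ => [|a b a' b' <- <-|//]; rewrite ?dot0l ?dotDl.
split=> [x y x'|x y y'|x y x' y'].
- rewrite dotZl -mulrDr ler_wpM2l// dot_suml -big_split/=.
  by apply: ler_sum => i _; exact: coupling_convex.
- rewrite dotZl -mulrDr ler_wpM2l// dot_suml -big_split/=.
  by apply: ler_sum => i _; exact: coupling_concave.
rewrite -!scalerBr -!sumrB -!(@sampling_rescale _ _ L L0 aL0).
- apply: le_trans (lerD (nsq_mean _ _ _) (nsq_mean _ _ _)) _.
  rewrite -big_split/= -[leRHS]mul1r -(sampling_weight_sum1 aL0) mulr_suml.
  by apply: ler_sum => i _; rewrite -mulrDr ler_wpM2l ?rescaled_lipschitz ?sampling_weight_ge0.
- by move=> i Li0; have [_ ->] := coupling_const x y x' y' Li0.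
- by move=> i Li0; have [-> _] := coupling_const x y x' y' Li0.
Qed.

End average_coupling.

(** * Variance-reduced extragradient method *)

Lemma subgrad_add_quadratic (R : realType) (d : nat) (phi : 'rV[R]_d -> R) mu beta xc u g :
  subgrad phi mu u (g + beta *: (xc - u)) ->
  subgrad (fun x => phi x + beta / 2 * nsq (x - xc)) (mu + beta) u g.
Proof.
move=> su s; have := su s; have -> : s - xc = (s - u) - (xc - u).
  by apply/rowP => j; rewrite !mxE; ring.
by rewrite (nsqD (s - u)) (nsqBC u) nsqN dotNr (dotDl g) dotZl (dotC (xc - u)); lra.
Qed.

(** [u] is the leading step with gradient [a], [z'] the corrected step with gradient [b], both from
    the same anchor. The inequality at [u] is tested at [z'], the one at [z'] at [s], and the two
    are added. *)
Lemma vr_extragradient_block (R : realType) (d : nat) (psi : 'rV[R]_d -> R) (mu c t : R)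
    (a b z w u z' s : 'rV[R]_d) : 0 <= mu ->
  subgrad psi mu u (c *: ((1 - t) *: z + t *: w - u) - a) ->
  subgrad psi mu z' (c *: ((1 - t) *: z + t *: w - z') - b) ->
  (c + mu) * nsq (z' - s) <=
    c * ((1 - t) * nsq (z - s) + t * nsq (w - s)) - c * (1 - t) * nsq (u - z)
    - c * t * nsq (u - w) - c * nsq (z' - u) + 2 * dot (b - a) (u - z')
    + 2 * dot b (s - u) + 2 * (psi s - psi u).
Proof.
move=> mu0 /(_ z') + /(_ s); have := mulr_ge0 mu0 (nsq_ge0 (z' - u)).
have -> : (1 - t) *: z + t *: w - u = (1 - t) *: (z - u) + t *: (w - u).
  by apply/rowP => j; rewrite !mxE; ring.
have -> : (1 - t) *: z + t *: w - z' = (1 - t) *: (z - u) + t *: (w - u) - (z' - u).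
  by apply/rowP => j; rewrite !mxE; ring.
have -> : s - z' = (s - u) - (z' - u) by rewrite opprB addrA subrK.
have -> : z' - s = (z' - u) - (s - u) by rewrite opprB addrA subrK.
have -> : z - s = (z - u) - (s - u) by rewrite opprB addrA subrK.
have -> : w - s = (w - u) - (s - u) by rewrite opprB addrA subrK.
rewrite (nsqBC u z) (nsqBC u w) -(opprB z' u).
move: (z - u) (w - u) (z' - u) (s - u) => Z W Z' S.
rewrite /nsq !dotE ?(dotC S Z') ?(dotC S Z) ?(dotC S W) ?(dotC Z' Z) ?(dotC Z' W) ?(dotC W Z).
by move=> h0 h1 h2; lra.
Qed.

Definition anchor (R : realType) (d : nat) (t : R) (z w : 'rV[R]_d) := (1 - t) *: z + t *: w.

Section inner_algorithm.
Context {R : realType} {dx dy m : nat}.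
Notation X := 'rV[R]_dx.
Notation Y := 'rV[R]_dy.
Notation algorithm := (algorithm R dx dy m).
Variables (q : fin_dist R m) (r : 'I_m -> R) (c beta : {posnum R}) (xc : X).

Definition prox_x (zb a : X) (k : X -> algorithm) : algorithm :=
  @Call _ _ _ _ ProxF (a, (c%:num + beta%:num)%:pos, prox_center c%:num beta%:num zb xc) k.

Definition prox_y (zb a : Y) (k : Y -> algorithm) : algorithm :=
  @Call _ _ _ _ ProxH (a, c, zb) k.

(* The inner loop of the variance-reduced extragradient method of Alacaoglu and
   Malitsky with snapshot [(wx, wy)], where the gradient is [(Fx, Fy)]. *)
Fixpoint vr_steps (n : nat) (wx Fx : X) (wy Fy : Y) (zx : X) (zy : Y) : algorithm :=
  if n is n'.+1 then
    prox_x (anchor m%:R^-1 zx wx) Fx (fun ux =>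
    prox_y (anchor m%:R^-1 zy wy) (- Fy) (fun uy =>
    Draw q (fun i =>
    @Call _ _ _ _ GradX (i, ux, uy) (fun gu =>
    @Call _ _ _ _ GradX (i, wx, wy) (fun gw =>
    @Call _ _ _ _ GradY (i, ux, uy) (fun ku =>
    @Call _ _ _ _ GradY (i, wx, wy) (fun kw =>
    prox_x (anchor m%:R^-1 zx wx) (Fx + r i *: (gu - gw)) (fun zx' =>
    prox_y (anchor m%:R^-1 zy wy) (- (Fy + r i *: (ku - kw))) (fun zy' =>
    vr_steps n' wx Fx wy Fy zx' zy')))))))))
  else Return zx zy.

(** With [m] inner steps per epoch, the full gradient at a new snapshot costs no more than the steps
    that use it. *)
Fixpoint vr_epochs (K : nat) (zx : X) (zy : Y) : algorithm :=
  if K is K'.+1 then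
    with_gradient zx zy (fun Fx Fy =>
    bind (vr_steps m zx Fx zy Fy zx zy) (vr_epochs K'))
  else Return zx zy.

Lemma max_calls_vr_steps O cl n wx Fx wy Fy zx zy :
  (max_calls O cl (vr_steps n wx Fx wy Fy zx zy) <= 2 * n)%N.
Proof.
have one : (`[< ProxF = cl >] + `[< ProxH = cl >] + `[< GradX = cl >] + `[< GradY = cl >] <= 1)%N.
  by case: cl; do 4!case: asboolP => //.
elim: n zx zy => //= n IH zx zy.
apply: (@leq_trans (`[< ProxF = cl >] + (`[< ProxH = cl >] +
  (2 * (`[< GradX = cl >] + `[< GradY = cl >]) + `[< ProxF = cl >] + `[< ProxH = cl >] + 2 * n))));
  last by lia.
rewrite !leq_add2l; apply/bigmax_leqP => i _; rewrite !addnA.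
apply: leq_trans (leq_add (leqnn _) (IH _ _)) _; lia.
Qed.

Lemma max_calls_vr_epochs O cl K zx zy :
  (max_calls O cl (vr_epochs K zx zy) <= K * (3 * m))%N.
Proof.
elim: K zx zy => //= K IH zx zy.
apply: leq_trans (max_calls_with_gradient _ _ _ _ _) _.
rewrite mulSn; apply: leq_trans (leq_add (leqnn m) (max_calls_bind _ (IH : forall x y, _))) _.
by rewrite addnA leq_add2r mulSn leq_add2l max_calls_vr_steps.
Qed.

End inner_algorithm.

Section inner_analysis.
Context {R : realType} {dx dy m : nat}.
Notation X := 'rV[R]_dx.
Notation Y := 'rV[R]_dy.
Variables (f : X -> R) (h : Y -> R) (Gi : 'I_m -> X -> Y -> R) (O : oracle R dx dy m).
Arguments O : clear implicits.
Variables (L : 'I_m -> R) (mux muy : R).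
Hypotheses (L0 : forall i, 0 <= L i) (aL0 : 0 < average L).
Hypotheses (mux0 : 0 < mux) (muxy : mux <= muy) (muyL : muy * Num.sqrt m%:R <= average L).

(** This and [oracle_prox] are all that the analysis assumes about the oracle. Both survive the
    exchange of the players. *)
Definition oracle_coupling := forall i, coupling (Gi i)
  (fun x y => O GradX (i, x, y)) (fun x y => O GradY (i, x, y)) (L i ^+ 2).
Definition oracle_prox :=
  (forall a (c : {posnum R}) z, let u := O ProxF (a, c, z) in
     subgrad f mux u (c%:num *: (z - u) - a)) /\
  (forall a (c : {posnum R}) z, let u := O ProxH (a, c, z) in
     subgrad h muy u (c%:num *: (z - u) - a)).

Hypotheses (cGi : oracle_coupling) (pO : oracle_prox).

Let G x y := average (fun i => Gi i x y).
Let gx := mean_gradx O.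
Let gy := mean_grady O.
Let cG : coupling G gx gy (average L ^+ 2) := average_coupling L0 aL0 cGi.

Let muy0 : 0 < muy. Proof. exact: lt_le_trans muxy. Qed.
Let m1 : 1 <= m%:R :> R. Proof. exact: average_gt0_card aL0. Qed.
Let m0 : 0 < m%:R :> R. Proof. exact: lt_le_trans m1. Qed.

Variables (c beta : {posnum R}) (xc : X).
Hypothesis cE : c%:num = average L * Num.sqrt m%:R.
Hypothesis betaE : beta%:num = muy.

Variables (sx : X) (sy : Y).
Hypothesis saddle : saddle_eq f h gx gy mux muy muy xc sx sy.

Let q := sampling L0 aL0.
Let r := rescale L.
Let V (x : X) (y : Y) := nsq (x - sx) + nsq (y - sy).

(** Holds for each draw separately. The last two terms cancel in the mean by [vr_mean_draw]; the
    objective differences are controlled by the saddle inequalities at [(ux, uy)]. *)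
Lemma vr_one_draw i (wx zx : X) (wy zy : Y) (ux zx' : X) (uy zy' : Y) :
  let Fx := gx wx wy in let Fy := gy wx wy in
  let ex := r i *: (O GradX (i, ux, uy) - O GradX (i, wx, wy)) in
  let ey := r i *: (O GradY (i, ux, uy) - O GradY (i, wx, wy)) in
  let bx := anchor m%:R^-1 zx wx in let by_ := anchor m%:R^-1 zy wy in
  subgrad f mux ux (c%:num *: (bx - ux) + beta%:num *: (xc - ux) - Fx) ->
  subgrad h muy uy (c%:num *: (by_ - uy) - - Fy) ->
  subgrad f mux zx' (c%:num *: (bx - zx') + beta%:num *: (xc - zx') - (Fx + ex)) ->
  subgrad h muy zy' (c%:num *: (by_ - zy') - - (Fy + ey)) ->
  (c%:num + muy) * V zx' zy' <=
    c%:num * ((1 - m%:R^-1) * V zx zy + m%:R^-1 * V wx wy)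
    + 2 * (dot (Fx + ex) (sx - ux) - dot (Fy + ey) (sy - uy))
    - 2 * (dot (gx ux uy) (sx - ux) - dot (gy ux uy) (sy - uy)).
Proof.
move=> Fx Fy ex ey bx by_.
rewrite addrAC => /subgrad_add_quadratic sux suy.
rewrite addrAC => /subgrad_add_quadratic szx szy.
have mub : 0 <= mux + beta%:num by rewrite addr_ge0 ?ltW.
have := vr_extragradient_block sx mub sux szx.
have := vr_extragradient_block sy (ltW muy0) suy szy.
have k0 : 0 <= c%:num * (1 - m%:R^-1) by rewrite mulr_ge0// subr_ge0 invf_le1.
have := mulr_ge0 k0 (nsq_ge0 (ux - zx)); have := mulr_ge0 k0 (nsq_ge0 (uy - zy)).
have := mulr_ge0 (ltW mux0) (nsq_ge0 (zx' - sx)).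
have c0 : 0 < c%:num by [].
have := young ex (ux - zx') c0; have := young (- ey) (uy - zy') c0.
have := rescaled_lipschitz cGi i ux uy wx wy.
rewrite -/r -/ex -/ey.
(* This identity dictates [c]: the variance term [average L ^+ 2 / c] times the squared distance
   from [u] to the snapshot is cancelled by the gain [c / m] from the pull of the anchor. *)
have -> : average L ^+ 2 = c%:num * (c%:num * m%:R^-1).
  have s0 : Num.sqrt m%:R != 0 :> R by rewrite gt_eqF ?sqrtr_gt0.
  have <- := sqr_sqrtr (ltW m0).
  by rewrite cE; move: (Num.sqrt _) s0 => s s0; field.
rewrite -(mulrA c%:num (_ / _)) -ler_pdivrMl//.
have := saddle_eq_min ux cG saddle; have := saddle_eq_max uy cG saddle.
have := coupling_convex cG ux uy sx; have := coupling_concave cG ux uy sy.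
have := mulr_ge0 (ltW muy0) (nsq_ge0 (ux - sx)).
have := mulr_ge0 (ltW mux0) (nsq_ge0 (ux - sx)).
have := mulr_ge0 (ltW muy0) (nsq_ge0 (uy - sy)).
have -> : Fx + ex - Fx = ex by rewrite addrC addKr.
have -> : - (Fy + ey) - - Fy = - ey by rewrite opprK opprD addrAC addNr add0r.
rewrite /V betaE (nsqBC uy zy') (nsqBC ux zx') nsqN.
rewrite (dotNl (Fy + ey)).
by lra.
Qed.

(** Unbiasedness of the estimator: in the mean the correction replaces the snapshot gradient by the
    one at [(ux, uy)]. *)
Lemma vr_mean_draw (wx : X) (wy : Y) ux uy :
  \sum_(i < m) q i * (dot (gx wx wy + r i *: (O GradX (i, ux, uy) - O GradX (i, wx, wy))) (sx - ux)
     - dot (gy wx wy + r i *: (O GradY (i, ux, uy) - O GradY (i, wx, wy))) (sy - uy)) =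
  dot (gx ux uy) (sx - ux) - dot (gy ux uy) (sy - uy).
Proof.
have mean d (F v : 'rV[R]_d) (w w' : 'I_m -> 'rV[R]_d) :
    F = m%:R^-1 *: \sum_i w' i -> (forall i, L i = 0 -> w i - w' i = 0) ->
    \sum_(i < m) q i * dot (F + r i *: (w i - w' i)) v = dot (m%:R^-1 *: \sum_i w i) v.
  move=> FE w0; have : m%:R^-1 *: \sum_i w i = \sum_i q i *: (F + r i *: (w i - w' i)).
    under [RHS]eq_bigr do rewrite scalerDr.
    rewrite big_split/= -scaler_suml (weight_sum1 q) scale1r sampling_rescale//.
    by rewrite sumrB scalerBr FE addrC subrK.
  move=> ->; elim/big_ind2: _ => [|a b a' b' -> ->|i _]; first by rewrite dot0l.
    by rewrite dotDl.
  by rewrite dotZl.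
under eq_bigr do rewrite mulrBr.
rewrite sumrB !mean//.
- by move=> i Li0; have [_ ->] := coupling_const cGi ux uy wx wy Li0.
- by move=> i Li0; have [-> _] := coupling_const cGi ux uy wx wy Li0.
Qed.

(** [rate] and [rate'] weigh the current iterate and the snapshot in the recursion for one inner
    step. *)
Let rate := c%:num * (1 - m%:R^-1) / (c%:num + muy).
Let rate' := c%:num / (m%:R * (c%:num + muy)).

Lemma prox_x_subgrad zb a : let u := O ProxF (a, (c%:num + beta%:num)%:pos,
    prox_center c%:num beta%:num zb xc) in
  subgrad f mux u (c%:num *: (zb - u) + beta%:num *: (xc - u) - a).
Proof.
have [+ _] := pO => /(_ a (c%:num + beta%:num)%:pos (prox_center c%:num beta%:num zb xc)) /=.
by rewrite prox_centerE.
Qed.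

Let cmuy0 : 0 < c%:num + muy. Proof. by rewrite addr_gt0. Qed.

Lemma expect_vr_step wx wy zx zy zx' zy' :
  let ux := O ProxF (gx wx wy, (c%:num + beta%:num)%:pos,
    prox_center c%:num beta%:num (anchor m%:R^-1 zx wx) xc) in
  let uy := O ProxH (- gy wx wy, c, anchor m%:R^-1 zy wy) in
  (forall i, zx' i = O ProxF
     (gx wx wy + r i *: (O GradX (i, ux, uy) - O GradX (i, wx, wy)),
      (c%:num + beta%:num)%:pos, prox_center c%:num beta%:num (anchor m%:R^-1 zx wx) xc)) ->
  (forall i, zy' i = O ProxH
     (- (gy wx wy + r i *: (O GradY (i, ux, uy) - O GradY (i, wx, wy))),
      c, anchor m%:R^-1 zy wy)) ->
  \sum_(i < m) q i * V (zx' i) (zy' i) <= rate * V zx zy + rate' * V wx wy.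
Proof.
move=> ux uy zxE zyE.
have -> : rate * V zx zy + rate' * V wx wy =
    c%:num * ((1 - m%:R^-1) * V zx zy + m%:R^-1 * V wx wy) / (c%:num + muy).
  by rewrite /rate /rate'; field; rewrite !gt_eqF.
rewrite ler_pdivlMr// mulrC mulr_sumr.
pose B i := dot (gx wx wy + r i *: (O GradX (i, ux, uy) - O GradX (i, wx, wy))) (sx - ux)
     - dot (gy wx wy + r i *: (O GradY (i, ux, uy) - O GradY (i, wx, wy))) (sy - uy).
set A := c%:num * _; pose T := dot (gx ux uy) (sx - ux) - dot (gy ux uy) (sy - uy).
have -> : A = \sum_(i < m) q i * (2 * B i + (A - 2 * T)).
  have BT : \sum_(i < m) q i * B i = T by exact: vr_mean_draw.
  by rewrite weighted_affine BT; ring.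
apply: ler_sum => i _; rewrite mulrCA ler_wpM2l ?weight_ge0//.
have [_ pH] := pO.
rewrite addrA (addrC (2 * _)); apply: vr_one_draw; rewrite ?zxE ?zyE;
  [exact: prox_x_subgrad|exact: pH|exact: prox_x_subgrad|exact: pH].
Qed.

Lemma expect_vr_steps n wx wy zx zy :
  expect O V (vr_steps q r c beta xc n wx (gx wx wy) wy (gy wx wy) zx zy)
  <= rate ^+ n * V zx zy + rate' * (\sum_(j < n) rate ^+ j) * V wx wy.
Proof.
have rate0 : 0 <= rate.
  by rewrite divr_ge0 ?mulr_ge0 ?(ltW cmuy0)// subr_ge0 invf_le1.
elim: n zx zy => [|n IH] zx zy; first by rewrite /= expr0 big_ord0; lra.
rewrite big_ord_recr exprS /=.
have step := @expect_vr_step wx wy zx zy _ _ (fun=> erefl) (fun=> erefl).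
have {}step := ler_wpM2l (exprn_ge0 n rate0) step.
set S := \sum_(j < n) _; rewrite -/S in IH.
set s := (X in rate ^+ n * X <= _) in step.
apply: (@le_trans _ _ (rate ^+ n * s + rate' * S * V wx wy)); last by lra.
rewrite /s -weighted_affine; apply: ler_sum => i _.
apply: ler_wpM2l; first exact: sampling_weight_ge0.
exact: IH.
Qed.

(** The left side [e n] satisfies [e n.+1 = rate * e n + rate']. The linear bound propagates along
    an epoch since [m * (muy / c) <= 1]. *)
Lemma vr_rate n : (n <= m)%N ->
  rate ^+ n + rate' * (\sum_(j < n) rate ^+ j) <= 1 - n%:R * (muy / c%:num) / 3.
Proof.
have geo k : (1 - rate) * (\sum_(j < k) rate ^+ j) = 1 - rate ^+ k.
  by have := subrX1 rate k; lra.
have k0 : 0 <= muy / c%:num by rewrite divr_ge0// ltW.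
have mk1 : m%:R * (muy / c%:num) <= 1.
  rewrite mulrA ler_pdivrMr// mul1r cE -[X in X * muy](sqr_sqrtr (ltW m0)).
  by rewrite expr2 -mulrA mulrC ler_wpM2r ?sqrtr_ge0// mulrC.
have mm1 : m%:R * m%:R^-1 = 1 :> R by rewrite mulfV// gt_eqF.
have mi0 : 0 < m%:R^-1 :> R by rewrite invr_gt0.
have kc : c%:num * (muy / c%:num) = muy by rewrite mulrC divfK.
pose k := muy / c%:num; rewrite -/k in k0 mk1 kc *.
have k10 : 0 < 1 + k by lra.
have rateE : rate = (1 - m%:R^-1) / (1 + k).
  by rewrite /rate -kc; field; rewrite kc !gt_eqF.
have rate'E : rate' = m%:R^-1 / (1 + k).
  by rewrite /rate' -kc; field; rewrite kc !gt_eqF.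
elim: n => [|n IH] nm; first by rewrite big_ord0 expr0; lra.
have {}IH := IH (ltnW nm); have gn := geo n.
set S := \sum_(j < n) _ in IH gn *.
have -> : rate ^+ n.+1 + rate' * (\sum_(j < n.+1) rate ^+ j) =
    rate * (rate ^+ n + rate' * S) + rate'.
  rewrite big_ord_recr exprS/= -/S; have -> : rate ^+ n = 1 - (1 - rate) * S by lra.
  ring.
have rate0 : 0 <= rate by rewrite rateE divr_ge0 ?(ltW k10)// subr_ge0 invf_le1.
apply: le_trans (lerD (ler_wpM2l rate0 IH) (lexx _)) _.
rewrite rateE rate'E mulrAC -mulrDl ler_pdivrMr//.
have nm' : n%:R <= m%:R - 1 :> R by rewrite lerBrDr natr1 ler_nat.
have nk : n%:R * k <= m%:R * k - k by nra.
have n0 : 0 <= n%:R :> R by [].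
rewrite -(natr1 n).
have h1 : (n%:R + 1) * k * k <= k by rewrite ler_piMl//; nra.
have h2 : m%:R^-1 * (n%:R * k) <= k by rewrite -ler_pdivlMl ?invrK; nra.
nra.
Qed.

(** The bound of [vr_rate] at [n = m], with [c = average L * sqrt m] inserted. *)
Definition epoch_rate := 1 - muy * Num.sqrt m%:R / average L / 3.

Lemma epoch_rate_ge : 2 / 3 <= epoch_rate.
Proof.
have : muy * Num.sqrt m%:R / average L <= 1 by rewrite ler_pdivrMr// mul1r.
by rewrite /epoch_rate; lra.
Qed.

Lemma expect_vr_epochs K zx zy :
  expect O V (vr_epochs q r c beta xc K zx zy) <= epoch_rate ^+ K * V zx zy.
Proof.
have rate_epoch : rate ^+ m + rate' * (\sum_(j < m) rate ^+ j) <= epoch_rate.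
  apply: le_trans (vr_rate (leqnn m)) _; rewrite /epoch_rate cE.
  have s0 : Num.sqrt m%:R != 0 :> R by rewrite gt_eqF ?sqrtr_gt0.
  have sE := sqr_sqrtr (ltW m0); move: (Num.sqrt m%:R) s0 sE => s s0 <-.
  by rewrite le_eqVlt; apply/orP; left; apply/eqP; field; rewrite s0 gt_eqF.
have V0 x y : 0 <= V x y by rewrite addr_ge0 ?nsq_ge0.
have er0 : 0 <= epoch_rate by have := epoch_rate_ge; lra.
elim: K zx zy => [|K IH] zx zy; first by rewrite /= expr0 mul1r.
rewrite [vr_epochs _ _ _ _ _ _ _ _]/= expect_with_gradient expect_bind.
apply: le_trans (expect_le _ _ IH) _.
have -> : (fun x y => epoch_rate ^+ K * V x y) = (fun x y => epoch_rate ^+ K * V x y + 0).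
  by apply/funext => x; apply/funext => y; rewrite addr0.
rewrite expect_affine addr0 exprSr -mulrA ler_wpM2l ?exprn_ge0//.
apply: le_trans (expect_vr_steps m zx zy zx zy) _.
by rewrite -mulrDl ler_wpM2r.
Qed.

End inner_analysis.

(** * The accelerated algorithm *)

Section outer_algorithm.
Context {R : realType} {dx dy m : nat}.
Notation X := 'rV[R]_dx.
Notation Y := 'rV[R]_dy.
Notation algorithm := (algorithm R dx dy m).
Variables (q : fin_dist R m) (r : 'I_m -> R) (c beta l : {posnum R}) (a : R) (y0 : Y).

Definition prox_grad_step (x : X) (y : Y) (k : X -> Y -> algorithm) : algorithm :=
  with_gradient x y (fun Fx Fy =>
  @Call _ _ _ _ ProxF (Fx, l, x) (fun x' =>
  @Call _ _ _ _ ProxH (- Fy, l, y) (fun y' => k x' y'))).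

Definition extrapolate (x v : X) : X := (1 + a)^-1 *: (x + a *: v).

(** The inner solver starts at the extrapolated point, but its dual part always restarts from [y0].
    The last round is centered at [x] itself and keeps the dual output, so that a proximal gradient
    step can follow from a pair. *)
Fixpoint accelerated (N K : nat) (x v : X) : algorithm :=
  if N is N'.+1 then
    let y := extrapolate x v in
    bind (vr_epochs q r c beta y K y y0) (fun x' _ =>
    accelerated N' K x' ((1 - a) *: v + a *: y - a^-1 *: (y - x')))
  else
    bind (vr_epochs q r c beta x K x y0) (fun x' y' =>
    prox_grad_step x' y' (@Return _ _ _ _)).

Definition prox_grad_x (O : oracle R dx dy m) x y := O ProxF (mean_gradx O x y, l, x).
Definition prox_grad_y (O : oracle R dx dy m) x y := O ProxH (- mean_grady O x y, l, y).

Lemma expect_prox_grad_step O phi x y k :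
  expect O phi (prox_grad_step x y k) = expect O phi (k (prox_grad_x O x y) (prox_grad_y O x y)).
Proof. by rewrite expect_with_gradient. Qed.

Lemma max_calls_prox_grad_step O cl x y k :
  (max_calls O cl (prox_grad_step x y k) <=
    m + 1 + max_calls O cl (k (prox_grad_x O x y) (prox_grad_y O x y)))%N.
Proof.
apply: leq_trans (max_calls_with_gradient _ _ _ _ _) _.
rewrite -addnA leq_add2l /= addnA leq_add//.
by case: asboolP => [<-|]; case: asboolP.
Qed.

Lemma max_calls_accelerated O cl N K x v :
  (max_calls O cl (accelerated N K x v) <= N.+1 * (K * (3 * m)) + m + 1)%N.
Proof.
elim: N x v => [|N IH] x v /=.
  rewrite mul1n -addnA.
  apply: leq_trans (max_calls_bind _ (n := m + 1) _) _.
    by move=> x' y'; rewrite (leq_trans (max_calls_prox_grad_step _ _ _ _ _))// addn0.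
  by rewrite leq_add2r max_calls_vr_epochs.
apply: leq_trans (max_calls_bind _ (fun x' _ => IH _ _)) _.
rewrite [leqRHS](_ : _ = K * (3 * m) + (N.+1 * (K * (3 * m)) + m + 1))%N; last by lia.
by rewrite leq_add2r max_calls_vr_epochs.
Qed.

End outer_algorithm.

Section outer_analysis.
Context {R : realType} {dx dy m : nat}.
Notation X := 'rV[R]_dx.
Notation Y := 'rV[R]_dy.
Variables (f : X -> R) (h : Y -> R) (Gi : 'I_m -> X -> Y -> R) (O : oracle R dx dy m).
Arguments O : clear implicits.
Variables (L : 'I_m -> R) (mux muy : R).
Hypotheses (L0 : forall i, 0 <= L i) (aL0 : 0 < average L).
Hypotheses (mux0 : 0 < mux) (muxy : mux <= muy) (muyL : muy * Num.sqrt m%:R <= average L).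
Hypotheses (cGi : oracle_coupling Gi O L) (pO : oracle_prox f h O mux muy).

Let G x y := average (fun i => Gi i x y).
Let gx := mean_gradx O.
Let gy := mean_grady O.
Let cG : coupling G gx gy (average L ^+ 2) := average_coupling L0 aL0 cGi.

Let muy0 : 0 < muy. Proof. exact: lt_le_trans muxy. Qed.

Lemma muy_le_average : muy <= average L.
Proof.
apply: le_trans muyL; rewrite ler_peMr ?(ltW muy0)//.
by have := ler_wsqrtr (average_gt0_card aL0); rewrite sqrtr1.
Qed.

Lemma oracle_proxable : proxable f mux /\ proxable h muy.
Proof.
have [pF pH] := pO; split=> a c xbar c0.
  by exists (O ProxF (a, PosNum c0, xbar)); exact: (pF a (PosNum c0) xbar).
by exists (O ProxH (a, PosNum c0, xbar)); exact: (pH a (PosNum c0) xbar).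
Qed.

Lemma regularized_saddle_exists beta xc : 0 <= beta ->
  exists x y, saddle_eq f h gx gy mux muy beta xc x y.
Proof.
have [pf ph] := oracle_proxable.
exact: (saddle_exists mux0 muy0 (exprn_gt0 2 aL0) cG pf ph).
Qed.

Variables (c beta l : {posnum R}).
Hypotheses (cE : c%:num = average L * Num.sqrt m%:R) (betaE : beta%:num = muy).
Hypothesis lE : l%:num = average L.
Variables (xs : X) (ys y0 : Y).
Hypothesis saddle : saddle_eq f h gx gy mux muy 0 0 xs ys.

Let q := sampling L0 aL0.
Let r := rescale L.

Lemma prox_grad_step_spec x y :
  prox_grad f h gx gy mux muy (average L) x y (prox_grad_x l O x y) (prox_grad_y l O x y).
Proof.
have [pF pH] := pO; split; rewrite -lE; first exact: pF.
by have := pH (- gy x y) l y; rewrite opprK.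
Qed.

Section accelerated_analysis.
Variables (a D eps : R) (S : X -> X * Y).
(** [a ^+ 2] is the ratio of the strong convexity [mux / 2] of the envelope to its smoothness
    [muy]. *)
Hypotheses (a0 : 0 < a) (aE : a ^+ 2 * muy = mux / 2).
Hypothesis SP : forall x, saddle_eq f h gx gy mux muy muy x (S x).1 (S x).2.
Hypothesis D0 : nsq (y0 - ys) <= D.
Variable K : nat.
Let theta := epoch_rate L muy ^+ K.
Hypothesis theta_le : theta <= (mux / muy) ^+ 2 / 64.

Let M x := envelope f h G muy x (S x).1 (S x).2.
Let Ms := envelope f h G muy xs xs ys.
(** Nesterov's potential for the envelope. *)
Let E x v := M x - Ms + mux / 4 * nsq (v - xs).

Let a1 : a <= 1.
Proof.
rewrite -(@ler_pXn2r _ 2) ?nnegrE ?(ltW a0)// expr1n.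
rewrite -(ler_pM2r muy0) aE mul1r ler_pdivrMr // (le_trans muxy)//.
by rewrite ler_peMr ?(ltW muy0)// ler1n.
Qed.

Let theta0 : 0 <= theta.
Proof.
by rewrite exprn_ge0//; have := epoch_rate_ge aL0 muyL; lra.
Qed.

Let theta1 : theta <= 1.
Proof.
apply: le_trans theta_le _; rewrite ler_pdivrMr// mul1r.
have : (mux / muy) ^+ 2 <= 1 by rewrite exprn_ile1 ?divr_ge0 ?(ltW mux0) ?(ltW muy0)// ler_pdivrMr ?mul1r.
lra.
Qed.

Lemma envelope_ge x : Ms + mux / 4 * nsq (x - xs) <= M x.
Proof.
have := envelope_lower mux0 muxy cG (saddle_eq_center saddle) (SP x).
by rewrite subrr dot0l mulr0 addr0.
Qed.

Lemma potential_ge x v : mux / 4 * (nsq (x - xs) + nsq (v - xs)) <= E x v.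
Proof. by have := envelope_ge x; rewrite /E; lra. Qed.

(** The proximal map does not expand distances to the saddle point; the [2 * nsq (v - ys)] in
    [regularized_saddle_dist] pays for the triangle inequality in the dual variable. *)
Lemma inner_start x : nsq (x - (S x).1) + nsq (y0 - (S x).2) <= nsq (x - xs) + 2 * D.
Proof.
have := regularized_saddle_dist mux0 muxy cG (SP x) saddle.
have := nsqD_le (y0 - ys) (ys - (S x).2); rewrite addrA subrK (nsqBC ys).
by have := nsq_ge0 ((S x).1 - xs); have := D0; lra.
Qed.

Lemma potential_step x v x' y : y = extrapolate a x v ->
  E x' ((1 - a) *: v + a *: y - a^-1 *: (y - x')) <=
    (1 - a / 2) * E x v + muy * (1 + a^-1) * nsq (x' - (S y).1).
Proof.
move=> yE; have yS := SP y.
have H1 := envelope_lower mux0 muxy cG yS (SP x).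
have H2 := envelope_lower mux0 muxy cG yS (saddle_eq_center saddle).
have H3 := envelope_upper mux0 muxy cG yS (SP x').
have H4 := envelope_upper mux0 muxy cG yS (SP (S y).1).
have a2E : a ^+ 2 * muy / 2 = mux / 4 by rewrite aE; lra.
rewrite /E -a2E; apply: (@accelerated_step _ _ _ _ x v y _ (S y).1 x' xs (M x) (M y)) => //.
- by apply: le_trans H1; rewrite lerDl mulr_ge0 ?nsq_ge0// divr_ge0// ltW.
- by rewrite a2E.
- have := envelope_ge (S y).1; have := mulr_ge0 (ltW mux0) (nsq_ge0 ((S y).1 - xs)).
  move: H4; rewrite -(opprB y) dotNr nsqN -/(nsq _) -!/(M _); lra.
- by have := envelope_ge x; have := mulr_ge0 (ltW mux0) (nsq_ge0 (x - xs)); lra.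
Qed.

Lemma expect_inner x phi (s t : R) : 0 <= s ->
  (forall x' y', phi x' y' <= s * (nsq (x' - (S x).1) + nsq (y' - (S x).2)) + t) ->
  expect O phi (vr_epochs q r c beta x K x y0) <=
    s * theta * (nsq (x - xs) + 2 * D) + t.
Proof.
move=> s0 phile; apply: le_trans (expect_le _ _ phile) _.
rewrite expect_affine lerD2r -mulrA ler_wpM2l//.
apply: le_trans (expect_vr_epochs L0 aL0 mux0 muxy muyL cGi pO cE betaE (SP x) K x y0) _.
by rewrite ler_wpM2l// inner_start.
Qed.

(** [rho] is what remains of the rate after inexactness, [w] the level that the error due to [D]
    imposes on the potential, and [delta] the squared distance from which a proximal gradient step
    reaches gap [eps]. *)
Let rho := 1 - a / 4.
Let w := 16 * muy / a ^+ 2 * theta * D.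
Let delta := eps * mux / (12 * average L ^+ 2).

(** Markov's inequality in pointwise form: beyond distance [delta] the left side is negative. *)
Lemma prox_grad_success x y : 0 < delta ->
  1 - (nsq (x - xs) + nsq (y - ys)) / delta <=
  expect O (fun x y => \1_(eps_solution f h G eps) (x, y))
    (prox_grad_step l x y (@Return _ _ _ _)).
Proof.
move=> delta0; have step := prox_grad_step_spec x y; rewrite expect_prox_grad_step /=.
move: (prox_grad_x _ _ _ _) (prox_grad_y _ _ _ _) step => x' y' step.
have [small|big] := leP (nsq (x - xs) + nsq (y - ys)) delta.
  have -> : \1_(eps_solution f h G eps) (x', y') = 1 :> R.
    rewrite indicE mem_set//.
    have [pf ph] := oracle_proxable.
    apply: (prox_grad_eps_solution mux0 muxy muy_le_average cG pf ph saddle step).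
    have k0 : 0 <= 12 * average L ^+ 2 / mux.
      by apply: divr_ge0; [exact: mulr_ge0 (sqr_ge0 _)|exact: ltW mux0].
    apply: le_trans (ler_wpM2l k0 small) _; rewrite /delta.
    by rewrite le_eqVlt; apply/orP; left; apply/eqP; field; rewrite !gt_eqF.
  by rewrite gerBl divr_ge0 ?addr_ge0 ?nsq_ge0// ltW.
apply: (@le_trans _ _ 0); last by rewrite indicE.
by rewrite subr_le0 ler_pdivlMr// mul1r ltW.
Qed.

Lemma expect_one_minus phi (alg : algorithm R dx dy m) :
  1 - expect O phi alg = expect O (fun x y => -1 * phi x y + 1) alg.
Proof. by rewrite expect_affine mulN1r addrC. Qed.

Let potential_ge0 x v : 0 <= E x v.
Proof.
apply: le_trans (potential_ge x v).
by rewrite mulr_ge0 ?addr_ge0 ?nsq_ge0// divr_ge0// ltW.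
Qed.

Let D0' : 0 <= D. Proof. by apply: le_trans D0; exact: nsq_ge0. Qed.

Lemma accelerated_inexactness x v :
  muy * (1 + a^-1) * theta * (nsq (extrapolate a x v - xs) + 2 * D) <=
  a / 4 * E x v + a / 4 * w.
Proof.
have an0 : a != 0 by rewrite gt_eqF.
have yE : nsq (extrapolate a x v - xs) <= 4 / mux * E x v.
  have a10 : 0 < 1 + a by rewrite addr_gt0.
  pose t := (1 + a)^-1.
  have t01 : 0 <= t <= 1 by rewrite /t invr_ge0 ltW//= invf_le1// lerDl ltW.
  have -> : extrapolate a x v - xs = t *: (x - xs) + (1 - t) *: (v - xs).
    by apply/rowP => j; rewrite !mxE /t; field; rewrite gt_eqF.
  apply: le_trans (nsq_convex _ _ t01) _.
  rewrite [leRHS]mulrAC ler_pdivlMr//.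
  have := potential_ge x v; move/andP: t01 => [t0 t1].
  have nx := nsq_ge0 (x - xs); have nv := nsq_ge0 (v - xs).
  have := ler_wpM2r nx t1; have : (1 - t) * nsq (v - xs) <= nsq (v - xs).
    by rewrite ler_piMl// lerBlDr lerDl.
  move=> h1 h2 h3.
  have := ler_wpM2l (ltW mux0) (lerD h2 h1); lra.
have c1 : muy * (1 + a^-1) <= 2 * muy / a.
  have -> : muy * (1 + a^-1) = (a + 1) * (muy / a) by field.
  by rewrite -mulrA ler_wpM2r ?divr_ge0 ?(ltW muy0) ?(ltW a0)//; have := a1; lra.
have q0 : 0 <= nsq (extrapolate a x v - xs) + 2 * D.
  by rewrite addr_ge0 ?nsq_ge0 ?mulr_ge0.
apply: (@le_trans _ _ (2 * muy / a * theta * (4 / mux * E x v + 2 * D))).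
  apply: ler_pM => //; first by rewrite !mulr_ge0 ?addr_ge0 ?invr_ge0 ?(ltW muy0) ?(ltW a0).
    by rewrite ler_wpM2r.
  by rewrite lerD2r.
have -> : 2 * muy / a * theta * (4 / mux * E x v + 2 * D) =
    8 * muy / (a * mux) * theta * E x v + a / 4 * w.
  by rewrite /w; field; rewrite an0 gt_eqF.
rewrite lerD2r ler_wpM2r//.
(* As [mux = 2 a^2 muy], the accuracy [(mux / muy)^2 / 64] makes this coefficient exactly
   [a / 4]. *)
apply: le_trans (ler_wpM2l _ theta_le) _; first
  by rewrite divr_ge0 ?mulr_ge0 ?(ltW muy0) ?(ltW a0) ?(ltW mux0).
have muE : mux = 2 * (a ^+ 2 * muy) by rewrite aE; field.
rewrite le_eqVlt; apply/orP; left; apply/eqP; rewrite muE; field.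
by rewrite an0 gt_eqF.
Qed.

(** In expectation the potential goes from [E] to at most [rho * E + (1 - rho) * w]. In the base
    case the last inner run and Markov's inequality cost [4 |x - xs|^2 <= 16 / mux * E], besides the
    term in [theta * D]. *)
Lemma accelerated_failure N x v : 0 < delta ->
  1 - prob_output O (eps_solution f h G eps) (accelerated q r c beta l a y0 N K x v) <=
  (16 / mux * (rho ^+ N * E x v + (1 - rho ^+ N) * w) + 4 * theta * D) / delta.
Proof.
move=> delta0; rewrite prob_outputE.
have di0 : 0 <= delta^-1 by rewrite invr_ge0 ltW.
elim: N x v => [|N IH] x v; rewrite [accelerated _ _ _ _ _ _ _ _ _ _ _]/= expect_bind expect_one_minus.
  apply: le_trans (expect_inner (s := 2 / delta) (t := 2 * nsq (x - xs) / delta) _ _) _.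
  - by rewrite mulr_ge0.
  - move=> x' y'; have := prox_grad_success x' y' delta0; rewrite mulN1r addrC => h1.
    have h2 := nsqD_le (x' - (S x).1) ((S x).1 - xs).
    have h3 := nsqD_le (y' - (S x).2) ((S x).2 - ys).
    rewrite !addrA !subrK in h2 h3.
    have h4 := regularized_saddle_dist mux0 muxy cG (SP x) saddle.
    have h5 : nsq (x' - xs) + nsq (y' - ys) <=
        2 * (nsq (x' - (S x).1) + nsq (y' - (S x).2)) + 2 * nsq (x - xs).
      by have := nsq_ge0 (x - (S x).1); have := nsq_ge0 ((S x).2 - ys); lra.
    by have := ler_wpM2l di0 h5; lra.
  rewrite expr0 subrr mul0r addr0 mul1r.
  have -> : 2 / delta * theta * (nsq (x - xs) + 2 * D) + 2 * nsq (x - xs) / delta =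
    (2 * (theta * nsq (x - xs)) + 2 * nsq (x - xs) + 4 * theta * D) / delta by ring.
  rewrite ler_wpM2r// lerD2r mulrAC ler_pdivlMr//.
  have := ler_wpM2r (nsq_ge0 (x - xs)) theta1.
  have := potential_ge x v; have := mulr_ge0 (ltW mux0) (nsq_ge0 (v - xs)) => h1 h2.
  by move=> /(ler_wpM2l (ltW mux0)); lra.
have rho0 : 0 <= rho by rewrite /rho; have := a1; lra.
pose s := 16 / mux * rho ^+ N * (muy * (1 + a^-1)) / delta.
pose t := (16 / mux * (rho ^+ N * ((1 - a / 2) * E x v) + (1 - rho ^+ N) * w) + 4 * theta * D) / delta.
have k0 : 0 <= 16 / mux * rho ^+ N by rewrite mulr_ge0 ?exprn_ge0// divr_ge0// ltW.
have s0 : 0 <= s.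
  by rewrite mulr_ge0// mulr_ge0// mulr_ge0 ?(ltW muy0)// addr_ge0// invr_ge0 ltW.
apply: le_trans (expect_inner (s := s) (t := t) s0 _) _.
- move=> x' y'; rewrite mulN1r addrC; apply: le_trans (IH _ _) _.
  have st := potential_step x' (erefl (extrapolate a x v)).
  have y'0 := nsq_ge0 (y' - (S (extrapolate a x v)).2).
  have k1 : 0 <= muy * (1 + a^-1) by rewrite mulr_ge0 ?(ltW muy0)// addr_ge0// invr_ge0 ltW.
  have {}st := le_trans st (lerD (lexx _) (ler_wpM2l k1 (_ : _ <=
    nsq (x' - (S (extrapolate a x v)).1) + nsq (y' - (S (extrapolate a x v)).2)))).
  rewrite lerDl in st; have h1 := ler_wpM2l k0 (st y'0).
  by have := ler_wpM2l di0 h1; rewrite /s /t; lra.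
have := ler_wpM2l di0 (ler_wpM2l k0 (accelerated_inexactness x v)).
rewrite exprS /s /t /rho; lra.
Qed.

Lemma potential_start x : nsq (x - xs) <= D -> E x x <= muy * D.
Proof.
move=> xD; have := envelope_upper mux0 muxy cG (saddle_eq_center saddle) (SP x).
rewrite subrr dot0l mulr0 addr0 => ub.
have := ler_wpM2l (ltW muy0) xD; have := ler_wpM2r (nsq_ge0 (x - xs)) muxy.
have := mulr_ge0 (ltW muy0) (nsq_ge0 (x - xs)).
by move: ub; rewrite /E /M /Ms; lra.
Qed.

Lemma accelerated_success N x Q sigma : 0 < delta -> 0 < Q -> nsq (x - xs) <= D ->
  theta <= Q^-1 -> rho ^+ N <= Q^-1 -> 532 * (muy / mux) ^+ 2 * D / delta <= sigma * Q ->
  1 - sigma <=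
    prob_output O (eps_solution f h G eps) (accelerated q r c beta l a y0 N K x x).
Proof.
move=> delta0 Q0 xD thQ rhoQ sQ; rewrite lerBlDr -lerBlDl.
apply: le_trans (accelerated_failure N x x delta0) _.
rewrite ler_pdivrMr//; rewrite -ler_pdivrMr// in sQ.
apply: (@le_trans _ _ (Q^-1 * (532 * (muy / mux) ^+ 2 * D))); last first.
  rewrite -ler_pdivrMr//; apply: le_trans sQ; move: (532 * _ * _) => u.
  by rewrite le_eqVlt; apply/orP; left; apply/eqP; ring.
have rho01 : 0 <= rho ^+ N <= 1.
  have rho0 : 0 <= rho by rewrite /rho; have := a1; lra.
  by rewrite exprn_ge0//= exprn_ile1// /rho lerBlDr lerDl divr_ge0// ltW.
(* [a ^+ 2 = mux / (2 * muy)] eliminates [a]. *)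
have wE : w = 32 * muy * (muy / mux) * theta * D.
  have muE : mux = 2 * (a ^+ 2 * muy) by rewrite aE; field.
  by rewrite /w muE; field; rewrite !gt_eqF.
have w0 : 0 <= w.
  by rewrite wE !mulr_ge0// ?invr_ge0 ?(ltW muy0) ?(ltW mux0).
have E0 := potential_ge0 x x; have := potential_start xD.
have thD := ler_wpM2r D0' thQ; have k1 : 1 <= muy / mux by rewrite ler_pdivlMr ?mul1r.
have wQ : w <= 32 * muy * (muy / mux) * (Q^-1 * D).
  rewrite wE -(mulrA _ theta) ler_wpM2l//.
  by rewrite !mulr_ge0// ?invr_ge0 ?(ltW muy0) ?(ltW mux0).
have QD0 : 0 <= Q^-1 * D by rewrite mulr_ge0// invr_ge0 ltW.
move=> EE; have {}EE : rho ^+ N * E x x <= Q^-1 * (muy * D).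
  by case/andP: rho01 => r0 r1; exact: ler_pM.
have {}wQ : (1 - rho ^+ N) * w <= 32 * muy * (muy / mux) * (Q^-1 * D).
  by apply: le_trans wQ; case/andP: rho01 => r0 r1; rewrite ler_piMl// lerBlDr lerDl.
have im0 : 0 <= 16 / mux by rewrite divr_ge0// ltW.
have := ler_wpM2l im0 (lerD EE wQ).
have -> : 16 / mux * (Q^-1 * (muy * D) + 32 * muy * (muy / mux) * (Q^-1 * D)) =
  (16 * (muy / mux) + 512 * (muy / mux) ^+ 2) * (Q^-1 * D) by ring.
have -> : Q^-1 * (532 * (muy / mux) ^+ 2 * D) = 532 * (muy / mux) ^+ 2 * (Q^-1 * D) by ring.
have k2 : muy / mux <= (muy / mux) ^+ 2 by rewrite expr2 ler_peMl// (le_trans _ k1).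
have := ler_wpM2r QD0 k2; have := ler_wpM2r QD0 k1; rewrite mul1r.
by move: thD; lra.
Qed.

End accelerated_analysis.
End outer_analysis.

(** * Complexity *)

Section iteration_count.
Context {R : realType}.
Implicit Types x Q : R.

(** The successor makes the count exceed [ln Q / x], which suffices because
    [1 - x <= expR (- x)]. *)
Definition iterations x Q : nat := (Num.truncn (ln Q / x)).+1.

Lemma iterations_contract x Q : 0 < x -> x <= 1 -> 0 < Q ->
  (1 - x) ^+ iterations x Q <= Q^-1.
Proof.
move=> x0 x1 Q0; apply: (@le_trans _ _ (expR (- x) ^+ iterations x Q)).
  by rewrite lerXn2r ?nnegrE ?subr_ge0 ?expR_ge0// expR_ge1Dx.
rewrite -expRM_natr -[leRHS]lnK ?posrE ?invr_gt0// ler_expR lnV ?posrE//.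
by rewrite mulNr lerN2 mulrC -ler_pdivrMr// ltW// truncnS_gt.
Qed.

Lemma iterations_le x Q : 0 < x -> x <= 1 -> 1 <= Q ->
  (iterations x Q)%:R <= (ln Q + 1) / x.
Proof.
move=> x0 x1 Q1; rewrite -natr1 mulrDl mul1r lerD ?invf_ge1//.
by rewrite (andP (truncn_itv _)).1// divr_ge0 ?ln_ge0// ltW.
Qed.

Lemma ln3_ge (x : R) : 3 <= x -> 2 / 3 <= ln x.
Proof.
move=> x3; have x0 : 0 < x by lra.
have := expR_ge1Dx (- ln x); rewrite expRN lnK ?posrE// => h.
have : x^-1 <= 3^-1 by rewrite lef_pV2 ?posrE.
lra.
Qed.

End iteration_count.

(* [60 = 10 * 6] combines [prox_grad_error_bound] with [prox_grad_move], and
   [532 = 16 + 512 + 4] sums the coefficients of [accelerated_success]. *)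
Lemma precision_le (R : realType) (L mux muy V eps sigma D : R) :
  0 < mux -> mux <= muy -> muy <= L -> 0 < eps -> 0 < sigma < 1 -> 0 <= V ->
  0 <= D -> D <= 60 * (L / mux) ^+ 2 * V ->
  let Q := 532 * (muy / mux) ^+ 2 * (1 + D / (eps * mux / (12 * L ^+ 2) * sigma)) in
  let S := L / mux + L / muy + L * V / eps + sigma^-1 in
  [/\ 3 <= S, 1 <= Q & ln Q <= 19 * ln S].
Proof.
move=> mux0 muxy muyL eps0 /andP[s0 s1] V0 D0 DV Q S.
have muy0 : 0 < muy by exact: lt_le_trans muxy.
have L0 : 0 < L by exact: lt_le_trans muyL.
have A1 : 1 <= L / mux by rewrite ler_pdivlMr// mul1r (le_trans muxy).
have A2 : 1 <= L / muy by rewrite ler_pdivlMr// mul1r.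
have A3 : 1 <= sigma^-1 by rewrite invf_ge1// ltW.
have A4 : 0 <= L * V / eps by rewrite divr_ge0 ?mulr_ge0 ?(ltW L0) ?(ltW eps0).
have S3 : 3 <= S by rewrite /S; lra.
have k1 : 1 <= muy / mux by rewrite ler_pdivlMr// mul1r.
have kS : muy / mux <= S.
  apply: (@le_trans _ _ (L / mux)); last by rewrite /S; lra.
  by rewrite ler_wpM2r// invr_ge0 ltW.
have d0 : 0 < eps * mux / (12 * L ^+ 2) * sigma by rewrite mulr_gt0// divr_gt0 ?mulr_gt0 ?exprn_gt0.
have Q1 : 1 <= Q.
  have h1 : 1 <= (muy / mux) ^+ 2 by rewrite exprn_ege1.
  have h2 : 0 <= D / (eps * mux / (12 * L ^+ 2) * sigma) by rewrite divr_ge0 ?(ltW d0).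
  have := mulr_ge0 (le_trans ler01 h1) h2.
  by rewrite /Q; move: ((muy / mux) ^+ 2) (D / _) h1 h2 => u v h1 h2 h3; nra.
split=> //.
have S0 : 0 < S by lra.
rewrite mulr_natl -lnXn// ler_ln ?posrE ?exprn_gt0//; last by lra.
(* [720 = 60 * 12], and the exponent is [5 = 3 + 1 + 1] for the three factors [(L / mux)^3],
   [L V / eps] and [sigma^-1]. *)
have dS : D / (eps * mux / (12 * L ^+ 2) * sigma) <= 720 * S ^+ 5.
  apply: (@le_trans _ _ (60 * (L / mux) ^+ 2 * V / (eps * mux / (12 * L ^+ 2) * sigma))).
    by rewrite ler_wpM2r// invr_ge0 ltW.
  have -> : 60 * (L / mux) ^+ 2 * V / (eps * mux / (12 * L ^+ 2) * sigma) =
      720 * ((L / mux) ^+ 3 * (L * V / eps) * sigma^-1).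
    by field; rewrite !gt_eqF.
  have -> : S ^+ 5 = S ^+ 3 * S * S by ring.
  apply: ler_wpM2l; first by lra.
  have B1 : (L / mux) ^+ 3 <= S ^+ 3.
    by rewrite lerXn2r ?nnegrE ?(le_trans ler01 A1) ?(ltW S0)// /S; lra.
  have B2 : L * V / eps <= S by rewrite /S; lra.
  have B3 : sigma^-1 <= S by rewrite /S; lra.
  have C1 : 0 <= (L / mux) ^+ 3 by rewrite exprn_ge0// (le_trans ler01 A1).
  have C3 : 0 <= sigma^-1 by rewrite (le_trans ler01 A3).
  by apply: ler_pM => //; [exact: mulr_ge0|exact: ler_pM].
have S5 : 1 <= S ^+ 5 by rewrite exprn_ege1//; lra.
have S6 : 729 <= S ^+ 6.
  have h3 : (3 : R) ^+ 6 <= S ^+ 6 by rewrite lerXn2r ?nnegrE ?(ltW S0).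
  by apply: le_trans h3; rewrite -natrX ler_nat.
have d1 : 1 + D / (eps * mux / (12 * L ^+ 2) * sigma) <= S ^+ 6 * S ^+ 5.
  by apply: (@le_trans _ _ (729 * S ^+ 5)); [lra|apply: ler_wpM2r; [lra|exact: S6]].
(* [19 = 6 + 2 + 6 + 5]: both 532 and 729 are at most [3^6 <= S^6], and [1 + 720 S^5 <= 729 S^5]. *)
have -> : S ^+ 19 = S ^+ 6 * S ^+ 2 * (S ^+ 6 * S ^+ 5) by ring.
have v0 : 0 <= D / (eps * mux / (12 * L ^+ 2) * sigma).
  by apply: divr_ge0; [exact: D0|exact: ltW d0].
apply: ler_pM; [|lra| |exact: d1].
  by apply: mulr_ge0; [lra|exact: sqr_ge0].
apply: ler_pM; [lra|exact: sqr_ge0|by apply: le_trans S6; lra|].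
by rewrite lerXn2r ?nnegrE ?(le_trans ler01 k1) ?(ltW S0).
Qed.

(** Since [l >= 2 / 3], [lnQ + 1 <= 21 l], whence [84 = 4 * 21] and [63 = 3 * 21]. The total is at
    most [(86 * 189 + 9) l^2 u] with [u] at most twice the square root, below [200 * 200]. *)
Lemma count_le (R : realType) (L mux muy a l lnQ : R) (m N K T : nat) :
  0 < mux -> mux <= muy -> muy * Num.sqrt m%:R <= L -> 1 <= m%:R :> R -> 0 < a -> a <= 1 ->
  a ^+ 2 * muy = mux / 2 -> 2 / 3 <= l -> lnQ <= 19 * l ->
  N%:R <= (lnQ + 1) / (a / 4) -> K%:R <= (lnQ + 1) / (muy * Num.sqrt m%:R / L / 3) ->
  (T <= m + 1 + (N.+1 * (K * (3 * m)) + m + 1))%N ->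
  T%:R <= 200 * 200 * Num.sqrt (m%:R * L ^+ 2 / (mux * muy)) * l ^+ 2.
Proof.
move=> mux0 muxy muyL m1 a0 a1 aE l0 lQ NE KE TE.
have muy0 : 0 < muy by exact: lt_le_trans muxy.
set s := Num.sqrt m%:R in muyL KE.
have sE : s ^+ 2 = m%:R by rewrite sqr_sqrtr.
have s0 : 0 < s by rewrite sqrtr_gt0; lra.
have L0 : 0 < L by apply: lt_le_trans muyL; rewrite mulr_gt0.
(* Up to constants and logarithms, [1 / a] outer iterations times [L / (muy s)] epochs times
   [m = s^2] calls. *)
pose u := s * L / (muy * a).
have u0 : 0 < u by rewrite divr_gt0 ?mulr_gt0.
have uW : u <= 2 * Num.sqrt (m%:R * L ^+ 2 / (mux * muy)).
  rewrite -(@ler_pXn2r _ 2) ?nnegrE ?(ltW u0) ?(mulr_ge0 _ (sqrtr_ge0 _))//.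
  have W0 : 0 <= m%:R * L ^+ 2 / (mux * muy).
    by apply: divr_ge0; apply: mulr_ge0; rewrite ?sqr_ge0 ?ler0n ?(ltW mux0) ?(ltW muy0).
  rewrite (exprMn _ 2 (Num.sqrt _)) sqr_sqrtr//.
  have muE : mux = 2 * (a ^+ 2 * muy) by rewrite aE; field.
  have -> : u ^+ 2 = 2 * (m%:R * L ^+ 2 / (mux * muy)).
    by rewrite /u -sE muE; field; rewrite !gt_eqF.
  by move: W0; lra.
have NE' : N.+1%:R <= 86 * l / a.
  rewrite -natr1; apply: (@le_trans _ _ (84 * l / a + 2 * l / a)); last by rewrite -mulrDl; lra.
  apply: lerD.
    apply: le_trans NE _; rewrite invf_div mulrA ler_wpM2r ?invr_ge0 ?(ltW a0)//; lra.
  by rewrite ler_pdivlMr// mul1r; lra.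
have KE' : K%:R <= 63 * l * L / (muy * s).
  apply: le_trans KE _.
  have -> : 63 * l * L / (muy * s) = (21 * l) / (muy * s / L / 3) by field; rewrite !gt_eqF.
  by rewrite ler_wpM2r ?invr_ge0 ?divr_ge0 ?mulr_ge0 ?(ltW L0) ?(ltW muy0) ?(ltW s0)//; lra.
have mE : m%:R <= u.
  rewrite /u ler_pdivlMr ?mulr_gt0// -sE expr2 -mulrA ler_pM2l//.
  apply: le_trans muyL; have -> : s * (muy * a) = muy * s * a by ring.
  by rewrite ler_piMr// ltW// mulr_gt0.
have NK : N.+1%:R * (K%:R * (3 * m%:R)) <= 86 * 189 * l ^+ 2 * u.
  have -> : 86 * 189 * l ^+ 2 * u = 86 * l / a * (63 * l * L / (muy * s) * (3 * m%:R)).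
    by rewrite /u -sE; field; rewrite !gt_eqF.
  by apply: ler_pM => //; apply: ler_wpM2r.
apply: (@le_trans _ _ (4 * m%:R + N.+1%:R * (K%:R * (3 * m%:R)))).
  rewrite -!natrM -natrD ler_nat; apply: leq_trans TE _.
  move: m1 (N.+1 * _)%N; rewrite (ler_nat R 1 m); clear => m1 X; lia.
have l2 : 4 / 9 <= l ^+ 2 by rewrite expr2; nra.
have W0 := sqrtr_ge0 (m%:R * L ^+ 2 / (mux * muy)).
move: (Num.sqrt (m%:R * L ^+ 2 / _)) uW W0 => W uW W0.
have h1 : u <= 9 / 4 * (l ^+ 2 * u) by have := ler_wpM2r (ltW u0) l2; lra.
have h2 := ler_wpM2l (le_trans (_ : 0 <= 4 / 9) l2) uW.
have {}h2 : l ^+ 2 * u <= l ^+ 2 * (2 * W) by apply: h2; lra.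
lra.
Qed.

Lemma variance_reduced_catalyst (R : realType) (dx dy m : nat) (mux muy : R) (L : 'I_m -> R)
    (x0 : 'rV[R]_dx) (y0 : 'rV[R]_dy) (eps sigma : R) :
  0 < mux -> mux <= muy -> (forall i, 0 <= L i) -> 0 < average L ->
  muy * Num.sqrt m%:R <= average L -> 0 < eps -> 0 < sigma < 1 ->
  exists alg : algorithm R dx dy m,
  forall (f : 'rV[R]_dx -> R) (h : 'rV[R]_dy -> R)
         (Gi : 'I_m -> 'rV[R]_dx -> 'rV[R]_dy -> R) (O : oracle R dx dy m),
    oracle_coupling Gi O L -> oracle_prox f h O mux muy ->
    let G := fun x y => average (fun i => Gi i x y) in
    1 - sigma <= prob_output O (eps_solution f h G eps) alg /\
    exists (xs : 'rV[R]_dx) (ys : 'rV[R]_dy),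
      saddle_point f h G xs ys /\
      forall c : call,
        (max_calls O c alg)%:R <=
          200 * 200 * Num.sqrt (m%:R * average L ^+ 2 / (mux * muy)) *
          log_factor (average L) mux muy (pair_norm (x0 - xs) (y0 - ys)) eps sigma ^+ 2.
Proof.
move=> mux0 muxy L0 aL0 muyL eps0 s01.
have muy0 : 0 < muy by exact: lt_le_trans muxy.
have m1 := average_gt0_card aL0.
have muL := muy_le_average aL0 mux0 muxy muyL.
have sm0 : 0 < Num.sqrt m%:R :> R by rewrite sqrtr_gt0; exact: lt_le_trans m1.
have c0 : 0 < average L * Num.sqrt m%:R by rewrite mulr_gt0.
pose a := Num.sqrt (mux / (2 * muy)).
have a0 : 0 < a by rewrite sqrtr_gt0 divr_gt0 ?mulr_gt0.
have aE : a ^+ 2 * muy = mux / 2.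
  by rewrite sqr_sqrtr ?divr_ge0 ?mulr_ge0 ?(ltW mux0) ?(ltW muy0)//; field; rewrite gt_eqF.
have a1 : a <= 1.
  rewrite -sqrtr1 ler_wsqrtr// ler_pdivrMr ?mulr_gt0// mul1r (le_trans muxy)//.
  by rewrite ler_peMl ?(ltW muy0)// ler1n.
have a40 : 0 < a / 4 by rewrite divr_gt0.
have a41 : a / 4 <= 1 by lra.
pose rho := muy * Num.sqrt m%:R / average L / 3.
have rho0 : 0 < rho by rewrite !divr_gt0// mulr_gt0.
have rho1 : rho <= 1.
  have : muy * Num.sqrt m%:R / average L <= 1 by rewrite ler_pdivrMr// mul1r.
  by rewrite /rho; lra.
(* A computable upper bound on the squared initial distance, by [prox_grad_error_bound]; the program
   learns it from its first step. *)
pose D x' y' := 10 * (average L / mux) ^+ 2 * (nsq (x0 - x') + nsq (y0 - y')).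
(* The fraction meets the precision asked by [accelerated_success]; the added 1 ensures
   [Q >= 64 (muy / mux)^2], as the inner accuracy requires. *)
pose Q x' y' := 532 * (muy / mux) ^+ 2 *
  (1 + D x' y' / (eps * mux / (12 * average L ^+ 2) * sigma)).
exists (prox_grad_step (PosNum aL0) x0 y0 (fun x' y' =>
  accelerated (sampling L0 aL0) (rescale L) (PosNum c0) (PosNum muy0) (PosNum aL0) a y0
    (iterations (a / 4) (Q x' y')) (iterations rho (Q x' y')) x0 x0)).
move=> f h Gi O cGi pO G.
have [xs [ys saddle]] := regularized_saddle_exists L0 aL0 mux0 muxy cGi pO 0 (lexx 0).
have cG : coupling G (mean_gradx O) (mean_grady O) (average L ^+ 2).
  exact: average_coupling.
have step := prox_grad_step_spec pO (l := PosNum aL0) erefl x0 y0.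
set x' := prox_grad_x _ _ _ _ in step; set y' := prox_grad_y _ _ _ _ in step.
pose V := nsq (x0 - xs) + nsq (y0 - ys).
have V0 : 0 <= V by rewrite addr_ge0 ?nsq_ge0.
have VD : V <= D x' y' by exact: (prox_grad_error_bound mux0 muxy muL cG saddle step).
have D0 : 0 <= D x' y' by exact: le_trans VD.
have DV : D x' y' <= 60 * (average L / mux) ^+ 2 * V.
  have := prox_grad_move mux0 muxy muL cG saddle step.
  have k0 : 0 <= 10 * (average L / mux) ^+ 2 by apply: mulr_ge0; [lra|exact: sqr_ge0].
  by move=> /(ler_wpM2l k0); rewrite /D /V; lra.
have [S3 Q1 lnQ] := precision_le mux0 muxy muL eps0 s01 V0 D0 DV.
rewrite -/(Q x' y') in Q1 lnQ.
have Q0 : 0 < Q x' y' by exact: lt_le_trans Q1.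
(* A selection of regularized saddle points for the analysis alone; the program does not depend on
   it. *)
have /boolp.choice[S SP] : forall x, exists z,
    saddle_eq f h (mean_gradx O) (mean_grady O) mux muy muy x z.1 z.2.
  move=> x; have [u [v uv]] := regularized_saddle_exists L0 aL0 mux0 muxy cGi pO x (ltW muy0).
  by exists (u, v).
have delta0 : 0 < eps * mux / (12 * average L ^+ 2).
  by apply: divr_gt0; apply: mulr_gt0 => //; exact: exprn_gt0.
have sigma0 : 0 < sigma by case/andP: s01.
split.
  rewrite prob_outputE expect_prox_grad_step -prob_outputE -/x' -/y'.
  have thQ : epoch_rate L muy ^+ iterations rho (Q x' y') <= (Q x' y')^-1.
    exact: (iterations_contract rho0 rho1 Q0).
  have v0 : 0 <= D x' y' / (eps * mux / (12 * average L ^+ 2) * sigma).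
    by apply: divr_ge0; [exact: D0|rewrite ltW// mulr_gt0].
  have k0 : 0 < (muy / mux) ^+ 2 by rewrite exprn_gt0// divr_gt0.
  have kv := mulr_ge0 (ltW k0) v0.
  have QE : Q x' y' = 532 * ((muy / mux) ^+ 2 + (muy / mux) ^+ 2 *
      (D x' y' / (eps * mux / (12 * average L ^+ 2) * sigma))).
    by rewrite -[X in 532 * (X + _)]mulr1 -mulrDr mulrA.
  have th : epoch_rate L muy ^+ iterations rho (Q x' y') <= (mux / muy) ^+ 2 / 64.
    apply: le_trans thQ _.
    have -> : (mux / muy) ^+ 2 / 64 = (64 * (muy / mux) ^+ 2)^-1 by field; rewrite !gt_eqF.
    rewrite lef_pV2 ?posrE//; last by apply: mulr_gt0; [lra|exact: k0].
    by rewrite QE; lra.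
  apply: (accelerated_success L0 aL0 mux0 muxy muyL cGi pO (c := PosNum c0) (beta := PosNum muy0)
    (l := PosNum aL0) erefl erefl erefl saddle a0 aE SP _ th delta0 Q0 _ thQ).
  - by apply: le_trans VD; rewrite /V lerDr nsq_ge0.
  - by apply: le_trans VD; rewrite /V lerDl nsq_ge0.
  - exact: (iterations_contract a40 a41 Q0).
  rewrite QE; set k := (muy / mux) ^+ 2 in k0 kv *; set d := eps * mux / _ in delta0 kv *.
  have -> : sigma * (532 * (k + k * (D x' y' / (d * sigma)))) =
      532 * (sigma * k) + 532 * k * D x' y' / d by field; rewrite !gt_eqF.
  have := mulr_ge0 (ltW sigma0) (ltW k0); move: (sigma * k) (532 * k * D x' y' / d); clear.
  by move=> u e u0; lra.
exists xs, ys; split; first exact: saddle_eq_saddle_point cG mux0 muy0 saddle.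
move=> cl; rewrite /log_factor pair_norm_sqr -/V.
have TE := max_calls_prox_grad_step (PosNum aL0) O cl x0 y0 (fun x' y' =>
  accelerated (sampling L0 aL0) (rescale L) (PosNum c0) (PosNum muy0) (PosNum aL0) a y0
    (iterations (a / 4) (Q x' y')) (iterations rho (Q x' y')) x0 x0).
rewrite -/x' -/y' in TE.
have {}TE := leq_trans TE (leq_add (leqnn _) (max_calls_accelerated _ _ _ _ _ _ _ _ _ _ _ _ _)).
move: (max_calls O cl _) TE => T TE.
have N1 := iterations_le a40 a41 Q1; have K1 := iterations_le rho0 rho1 Q1.
have l1 := ln3_ge S3.
exact: (count_le mux0 muxy muyL m1 a0 a1 aE l1 lnQ N1 K1 TE).
Qed.

(** * Exchanging the two players *)

Section swap.
Context {R : realType} {dx dy m : nat}.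
Notation X := 'rV[R]_dx.
Notation Y := 'rV[R]_dy.

Definition swap_call (c : call) : call :=
  match c with GradX => GradY | GradY => GradX | ProxF => ProxH | ProxH => ProxF end.

Definition swap_input (c : call) :
    @input R dy dx m c -> @input R dx dy m (swap_call c) :=
  match c with
  | GradX | GradY => fun q => (q.1.1, q.2, q.1.2)
  | ProxF | ProxH => id
  end.

(** The exchanged game has coupling [- Gi], hence the sign of the gradients. *)
Definition swap_answer (c : call) : @answer R dx dy (swap_call c) -> @answer R dy dx c :=
  match c with
  | GradX | GradY => fun g => - g
  | ProxF | ProxH => id
  end.

(* Exchanging the players turns [min_x max_y f + G - h] into
   [min_y max_x h - G - f]. *)
Fixpoint swap_algorithm (a : algorithm R dy dx m) : algorithm R dx dy m :=
  match a with
  | Return y x => Return x y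
  | @Call _ _ _ _ c q k =>
      Call (swap_input q) (fun r => swap_algorithm (k (swap_answer r)))
  | @Draw _ _ _ _ n p k => Draw p (fun i => swap_algorithm (k i))
  end.

Definition swap_oracle (O : oracle R dx dy m) : oracle R dy dx m :=
  fun c q => swap_answer (O (swap_call c) (swap_input q)).

Lemma prob_output_swap (O : oracle R dx dy m) (A : set (X * Y)) (B : set (Y * X)) a :
  (forall x y, B (y, x) -> A (x, y)) ->
  prob_output (swap_oracle O) B a <= prob_output O A (swap_algorithm a).
Proof.
move=> BA; elim: a => [y x|c q k IH|n p k IH] /=; last 2 first.
- exact: IH.
- by apply: ler_sum => i _; rewrite ler_wpM2l ?weight_ge0.
rewrite !indicE; have [/set_mem/BA/mem_set->//|_] := boolP ((y, x) \in B).
by case: (_ \in A).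
Qed.

Lemma max_calls_swap (O : oracle R dx dy m) c a :
  max_calls O c (swap_algorithm a) = max_calls (swap_oracle O) (swap_call c) a.
Proof.
elim: a => //= [c' q k IH|n p k IH]; last by apply: eq_bigr => i _; rewrite IH.
rewrite IH; congr (_ + _)%N; congr nat_of_bool; apply/asbool_equiv_eq.
by clear IH k q; split; case: c; case: c'.
Qed.

Variables (f : X -> R) (h : Y -> R) (Gi : 'I_m -> X -> Y -> R) (O : oracle R dx dy m).
Arguments O : clear implicits.

Let G x y := average (fun i => Gi i x y).
Let G' y x := average (fun i => - Gi i x y).

Let objectiveN x y : objective h f G' y x = - objective f h G x y.
Proof.
rewrite /objective /G' /average sumrN mulrN -/(average _) -/(G x y); lra.
Qed.

Lemma eps_solution_swap eps x y :
  eps_solution h f G' eps (y, x) -> eps_solution f h G eps (x, y).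
Proof.
move=> [M [M' [[[x1 _ x1E] ubM] [[y1 _ y1E] lbM'] MM']]]; exists (- M'), (- M); split.
- split; first by exists y1 => //; rewrite -y1E objectiveN opprK.
  move=> _ [y2 _ <-]; rewrite lerNr -objectiveN; apply: lbM'; by exists y2.
- split; first by exists x1 => //; rewrite -x1E objectiveN opprK.
  move=> _ [x2 _ <-]; rewrite lerNl -objectiveN; apply: ubM; by exists x2.
- by rewrite opprK addrC.
Qed.

Lemma saddle_point_swap x y : saddle_point h f G' y x -> saddle_point f h G x y.
Proof.
by move=> xyP x' y'; have := xyP y' x'; rewrite !objectiveN !lerN2 => -[].
Qed.

Lemma oracle_coupling_swap (L : 'I_m -> R) : oracle_coupling Gi O L ->
  oracle_coupling (fun i y x => - Gi i x y) (swap_oracle O) L.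
Proof.
move=> cGi i; split=> [y x y'|y x x'|y x y' x']; rewrite /swap_oracle /=.
- by rewrite dotNl -opprD lerN2; exact: (coupling_concave (cGi i)).
- by rewrite dotNl -opprD lerN2; exact: (coupling_convex (cGi i)).
rewrite -!opprD !nsqN addrC [X in _ <= _ * X]addrC.
exact: (coupling_lipschitz (cGi i)).
Qed.

Lemma oracle_prox_swap mux muy : oracle_prox f h O mux muy ->
  oracle_prox h f (swap_oracle O) muy mux.
Proof. by case. Qed.

End swap.

Lemma oracle_for_coupling (R : realType) (dx dy m : nat) (f : 'rV[R]_dx -> R) (h : 'rV[R]_dy -> R)
    (Gi : 'I_m -> 'rV[R]_dx -> 'rV[R]_dy -> R) (O : oracle R dx dy m) (L : 'I_m -> R) :
  (forall i, 0 <= L i) -> (forall i, convex_concave (Gi i)) -> (forall i, smooth (L i) (Gi i)) ->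
  oracle_for f h Gi O -> oracle_coupling Gi O L.
Proof.
move=> L0 ccGi sGi [OX OY _ _] i.
have -> : (fun x y => O GradX (i, x, y)) = gradx (Gi i).
  by apply/funext => x; apply/funext => y; exact: OX.
have -> : (fun x y => O GradY (i, x, y)) = grady (Gi i).
  by apply/funext => x; apply/funext => y; exact: OY.
exact: smooth_coupling.
Qed.

Lemma oracle_for_prox (R : realType) (dx dy m : nat) (f : 'rV[R]_dx -> R) (h : 'rV[R]_dy -> R)
    (Gi : 'I_m -> 'rV[R]_dx -> 'rV[R]_dy -> R) (O : oracle R dx dy m) mux muy :
  strongly_convex mux f -> strongly_convex muy h -> oracle_for f h Gi O ->
  oracle_prox f h O mux muy.
Proof.
move=> scf sch [_ _ pF pH]; split=> a c z /=.
  exact: (prox_subgrad scf (pF a c z)).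
exact: (prox_subgrad sch (pH a c z)).
Qed.

Theorem theorem15 (R : realType) :
  exists (C : R) (p : nat),
  forall (dx dy m : nat) (mux muy : R) (L : 'I_m -> R),
    (0 < m)%N -> 0 < mux -> 0 < muy -> (forall i, 0 <= L i) ->
    mux * Num.sqrt m%:R <= average L ->
    muy * Num.sqrt m%:R <= average L ->
  forall (x0 : 'rV[R]_dx) (y0 : 'rV[R]_dy) (eps sigma : R),
    0 < eps -> 0 < sigma < 1 ->
  exists alg : algorithm R dx dy m,
  forall (f : 'rV[R]_dx -> R) (h : 'rV[R]_dy -> R)
         (Gi : 'I_m -> 'rV[R]_dx -> 'rV[R]_dy -> R) (O : oracle R dx dy m),
    strongly_convex mux f -> strongly_convex muy h ->
    (forall i, convex_concave (Gi i)) -> (forall i, smooth (L i) (Gi i)) ->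
    oracle_for f h Gi O ->
    let G := fun x y => average (fun i => Gi i x y) in
    1 - sigma <= prob_output O (eps_solution f h G eps) alg /\
    exists (xs : 'rV[R]_dx) (ys : 'rV[R]_dy),
      saddle_point f h G xs ys /\
      forall c : call,
        (max_calls O c alg)%:R <=
          C * Num.sqrt (m%:R * average L ^+ 2 / (mux * muy)) *
          log_factor (average L) mux muy (pair_norm (x0 - xs) (y0 - ys))
                     eps sigma ^+ p.
Proof.
exists (200 * 200), 2%N => dx dy m mux muy L m0 mux0 muy0 L0 muxL muyL x0 y0 eps sigma eps0 s01.
have aL0 : 0 < average L.
  by apply: lt_le_trans muxL; rewrite mulr_gt0// sqrtr_gt0 ltr0n.
have [muxy|/ltW muyx] := leP mux muy.
  have [alg algP] := variance_reduced_catalyst x0 y0 mux0 muxy L0 aL0 muyL eps0 s01.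
  exists alg => f h Gi O scf sch ccGi sGi OP; apply: algP.
    exact: (oracle_for_coupling L0 ccGi sGi OP).
  exact: (oracle_for_prox scf sch OP).
have [alg algP] := variance_reduced_catalyst y0 x0 muy0 muyx L0 aL0 muxL eps0 s01.
exists (swap_algorithm alg) => f h Gi O scf sch ccGi sGi OP G.
have cO := oracle_coupling_swap (oracle_for_coupling L0 ccGi sGi OP).
have pO := oracle_prox_swap (oracle_for_prox scf sch OP).
have [prob [ys [xs [saddle calls]]]] := algP _ _ _ _ cO pO.
split.
  apply: le_trans prob _; apply: prob_output_swap => x y; exact: eps_solution_swap.
exists xs, ys; split; first exact: saddle_point_swap.
move=> c; rewrite max_calls_swap; apply: le_trans (calls _) _.
(* The bound is symmetric under the exchange of the players. *)
rewrite (mulrC muy) /log_factor (addrC (average L / muy)).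
suff -> : pair_norm (y0 - ys) (x0 - xs) = pair_norm (x0 - xs) (y0 - ys) by [].
by rewrite /pair_norm addrC.
Qed.
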